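(* Let $p\neq2$ be a prime and $m\in\mathbb{Q}_p^\times$. The distributions $\delta_{+}(Q(k)-m^2)$ and $\delta_-(Q(k)-m^2)$ on $\mathbb{Q}_p^4$ are invariant under $\mathcal{L}_+^{\uparrow}$.
   Context: $[x,y]=x_0y_0-x_1y_1-x_2y_2-x_3y_3$ on $\mathbb{Q}_p^4$, $Q(x)=[x,x]$. Positivity: $a=p^{ord(a)}ac(a)\in\mathbb{Q}_p^\times$, $|ac(a)|_p=1$, is positive ($a>0$) if the reduction of $ac(a)$ mod $p$ lies in $\{1,\dots,\frac{p-1}{2}\}$, and negative ($a<0$) otherwise. $V_{m^2}=\{k\in\mathbb{Q}_p^4:Q(k)=m^2\}$, $V_{m^2}^{\pm}=\{(k_0,\boldsymbol{k})\in V_{m^2}:\pm k_0>0\}$. $d\lambda_{m^2}$ is the measure on $V_{m^2}$ induced by the Gel'fand–Leray form, i.e. by the restriction to $V_{m^2}$ of any analytic $3$-form $\lambda$ with $dk_0\wedge dk_1\wedge dk_2\wedge dk_3=dQ\wedge\lambda$; on a piece of $V_{m^2}$ where $\partial Q/\partial k_l\neq0$ and $k_l$ is an analytic function of the other coordinates, it is the normalized Haar measure in the other three coordinates divided by $|\partial Q/\partial k_l|_p$. For $\varphi\in\mathbf{S}(\mathbb{Q}_p^4)$ (locally constant, compactly supported), $(\delta_\pm(Q(k)-m^2),\varphi)=\int_{V_{m^2}^\pm}\varphi\,d\lambda_{m^2}$. $SO(Q)=\{\Lambda\in GL_4(\mathbb{Q}_p):[\Lambda x,\Lambda y]=[x,y]\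 \forall x,y,\ \det\Lambda=1\}$; the $p$-adic restricted Lorentz group $\mathcal{L}_+^{\uparrow}$ is the largest subgroup of $SO(Q)$ with $\mathcal{L}_+^\uparrow(V_{m^2}^{\pm})=V_{m^2}^{\pm}$ (for both signs). For $\Lambda\in GL_4(\mathbb{Q}_p)$: $(\Lambda\varphi)(x)=\varphi(\Lambda^{-1}x)$, $(\Lambda T,\varphi)=(T,\Lambda^{-1}\varphi)$; a distribution $T$ is invariant under a group $G_0$ if $\Lambda T=T$ for all $\Lambda\in G_0$. *)

(* Defs.v *)
From HB Require Import structures.
From mathcomp Require Import all_boot all_order all_algebra.
From mathcomp Require Import finmap all_classical all_reals all_analysis.
From mathcomp Require Import analysis.showcase.summability.
From mathcomp Require Import fraction.
From mathcomp.real_closed Require Import complex.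

Set Implicit Arguments.
Unset Strict Implicit.
Unset Printing Implicit Defensive.

Import Order.TTheory GRing.Theory Num.Theory.

Local Open Scope classical_set_scope.
Local Open Scope ring_scope.

(* Z_p as the inverse limit of the rings Z/p^n: [residue x n] is the
   representative in [0, p^n) of x modulo p^n. *)
Record padic_int (p : nat) (p_pr : prime p) := PadicInt {
  residue :> nat -> nat;
  _ : forall n, (residue n.+1 %% p ^ n)%N = residue n }.

Section PadicInt.
Variables (p : nat) (p_pr : prime p).
Local Notation Zp := (padic_int p_pr).
Implicit Types x y z : Zp.

HB.instance Definition _ := gen_eqMixin Zp.
HB.instance Definition _ := gen_choiceMixin Zp.

Lemma residue_coh x n : (x n.+1 %% p ^ n)%N = x n.
Proof. by case: x. Qed.

Lemma residue_mod x n : (x n %% p ^ n)%N = x n.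
Proof. by rewrite -{1}residue_coh modn_mod residue_coh. Qed.

Lemma residue_coh_add x n k : (x (n + k)%N %% p ^ n)%N = x n.
Proof.
elim: k => [|k IHk]; first by rewrite addn0 residue_mod.
by rewrite addnS -IHk -(residue_coh x (n + k)) modn_dvdm // expnD dvdn_mulr.
Qed.

Lemma padic_int_ext x y : (forall n, x n = y n) -> x = y.
Proof.
case: x y => [x xP] [y yP] /= /funext exy.
by case: y / exy yP => yP; congr PadicInt; exact: Prop_irrelevance.
Qed.

Lemma padic_int_of_subproof (f : nat -> nat) :
  (forall n, f n.+1 = f n %[mod p ^ n]) ->
  forall n, (f n.+1 %% p ^ n.+1 %% p ^ n)%N = (f n %% p ^ n)%N.
Proof. by move=> fP n; rewrite modn_dvdm ?fP // expnS dvdn_mull. Qed.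

Definition padic_int_of (f : nat -> nat)
    (fP : forall n, f n.+1 = f n %[mod p ^ n]) : Zp :=
  PadicInt p_pr (padic_int_of_subproof fP).

Lemma padic_int_const_subproof (k : nat) n : k = k %[mod p ^ n].
Proof. by []. Qed.

Lemma padic_int_add_subproof x y n :
  (x n.+1 + y n.+1)%N = (x n + y n)%N %[mod p ^ n].
Proof. by rewrite -modnDm !residue_coh. Qed.

Lemma padic_int_mul_subproof x y n :
  (x n.+1 * y n.+1)%N = (x n * y n)%N %[mod p ^ n].
Proof. by rewrite -modnMm !residue_coh. Qed.

Lemma padic_int_opp_subproof x n :
  ((p ^ n.+1).-1 * x n.+1)%N = ((p ^ n).-1 * x n)%N %[mod p ^ n].
Proof.
have pn_gt0 k : (0 < p ^ k)%N by rewrite expn_gt0 prime_gt0.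
have addx (k : nat) : (k + x n)%N = (k + x n.+1)%N %[mod p ^ n].
  by rewrite -[in LHS]residue_coh modnDmr.
apply/eqP; rewrite -(eqn_modDr (x n)) addx -!mulSnr !prednK //.
by rewrite expnSr -mulnA !modnMr.
Qed.

Definition padic_int0 := padic_int_of (padic_int_const_subproof 0).
Definition padic_int1 := padic_int_of (padic_int_const_subproof 1).
Definition padic_int_add x y := padic_int_of (padic_int_add_subproof x y).
Definition padic_int_opp x := padic_int_of (padic_int_opp_subproof x).
Definition padic_int_mul x y := padic_int_of (padic_int_mul_subproof x y).

Lemma padic_int_addA : associative padic_int_add.
Proof.
by move=> x y z; apply: padic_int_ext => n /=; rewrite modnDml modnDmr addnA.
Qed.

Lemma padic_int_addC : commutative padic_int_add.
Proof. by move=> x y; apply: padic_int_ext => n /=; rewrite addnC. Qed.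

Lemma padic_int_add0 : left_id padic_int0 padic_int_add.
Proof.
by move=> x; apply: padic_int_ext => n /=; rewrite mod0n add0n residue_mod.
Qed.

Lemma padic_int_addN : left_inverse padic_int0 padic_int_opp padic_int_add.
Proof.
move=> x; apply: padic_int_ext => n /=.
by rewrite modnDml -mulSnr prednK ?expn_gt0 ?prime_gt0 // modnMr mod0n.
Qed.

HB.instance Definition _ := GRing.isZmodule.Build Zp
  padic_int_addA padic_int_addC padic_int_add0 padic_int_addN.

Lemma padic_int_mulA : associative padic_int_mul.
Proof.
by move=> x y z; apply: padic_int_ext => n /=; rewrite modnMml modnMmr mulnA.
Qed.

Lemma padic_int_mulC : commutative padic_int_mul.
Proof. by move=> x y; apply: padic_int_ext => n /=; rewrite mulnC. Qed.

Lemma padic_int_mul1 : left_id padic_int1 padic_int_mul.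
Proof.
move=> x; apply: padic_int_ext => n /=.
by rewrite modnMml mul1n residue_mod.
Qed.

Lemma padic_int_mulDl : left_distributive padic_int_mul padic_int_add.
Proof.
move=> x y z; apply: padic_int_ext => n /=.
by rewrite modnMml modnDm mulnDl.
Qed.

Lemma padic_int_1neq0 : padic_int1 != 0.
Proof.
apply/eqP => /(congr1 (fun x : Zp => x 1%N)) /=.
by rewrite expn1 mod0n modn_small // prime_gt1.
Qed.

HB.instance Definition _ := GRing.Zmodule_isComNzRing.Build Zp
  padic_int_mulA padic_int_mulC padic_int_mul1 padic_int_mulDl padic_int_1neq0.

Definition padic_int_unit : {pred Zp} := fun x => `[< exists y, y * x = 1 >].
Definition padic_int_inv x :=
  if x \in padic_int_unit then xget 0 [set y | y * x = 1] else x.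

Lemma padic_int_mulV : {in padic_int_unit, left_inverse 1 padic_int_inv *%R}.
Proof.
move=> x ux; rewrite /padic_int_inv ux.
by move/asboolP: ux => /(@xgetPex _ 0 [set y | y * x = 1]).
Qed.

Lemma padic_int_unitP x y : y * x = 1 -> padic_int_unit x.
Proof. by move=> yx1; apply/asboolP; exists y. Qed.

Lemma padic_int_invN : {in [predC padic_int_unit], padic_int_inv =1 id}.
Proof. by move=> x; rewrite inE /padic_int_inv => /negPf ->. Qed.

HB.instance Definition _ := GRing.ComNzRing_hasMulInverse.Build Zp
  padic_int_mulV padic_int_unitP padic_int_invN.

Lemma padic_int_neq0 x : x != 0 -> exists n, x n != 0%N.
Proof.
move=> x0; apply: contrapT => xn0; move/eqP: x0; apply.
apply: padic_int_ext => n; rewrite /= mod0n.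
by apply/eqP; apply: contrapT => /negP xn; apply: xn0; exists n.
Qed.

Lemma padic_int_integral x y : x * y = 0 -> (x == 0) || (y == 0).
Proof.
move=> xy0; apply: contraT; rewrite negb_or => /andP[/padic_int_neq0 [a xa]].
move=> /padic_int_neq0 [b yb].
have p_gt1 := prime_gt1 p_pr.
have xab := residue_coh_add x a b.
have yab := residue_coh_add y b a; rewrite addnC in yab.
have ndx : ~~ (p ^ a %| x (a + b))%N by rewrite /dvdn xab.
have ndy : ~~ (p ^ b %| y (a + b))%N by rewrite /dvdn yab.
have x_gt0 : (0 < x (a + b))%N by rewrite lt0n; apply: contraNneq ndx => ->.
have y_gt0 : (0 < y (a + b))%N by rewrite lt0n; apply: contraNneq ndy => ->.
have : (p ^ (a + b) %| x (a + b) * y (a + b))%N.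
  by move: (congr1 (fun z : Zp => z (a + b)%N) xy0) => /= /eqP; rewrite mod0n.
rewrite pfactor_dvdn // ?muln_gt0 ?x_gt0 // lognM //.
move: ndx ndy; rewrite !pfactor_dvdn // -!ltnNge => ltx lty.
by rewrite leqNgt -addSn leq_add // ltnW.
Qed.

HB.instance Definition _ := GRing.ComUnitRing_isIntegral.Build Zp
  padic_int_integral.

End PadicInt.

Definition padic (p : nat) (p_pr : prime p) : Type :=
  {fraction (padic_int p_pr)}.

Section Padic.
Variables (p : nat) (p_pr : prime p).
Local Notation Zp := (padic_int p_pr).
Local Notation Qp := (padic p_pr).

HB.instance Definition _ := GRing.Field.on Qp.
HB.instance Definition _ := isPointed.Build Qp 0.

Definition of_Zp (z : Zp) : Qp := FracField.tofrac z.

(* The p-adic topology, with x + p^n Z_p as basic neighbourhoods of x. *)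
Definition padic_open : set_system Qp := [set A | forall x, A x ->
  exists n : nat, forall z : Zp, A (x + p%:R ^+ n * of_Zp z)].

Lemma padic_openT : padic_open setT.
Proof. by move=> x _; exists 0%N. Qed.

Lemma padic_openI : setI_closed padic_open.
Proof.
have le_ball (A : set Qp) (x : Qp) (n k : nat) :
    (forall z : Zp, A (x + p%:R ^+ n * of_Zp z)) ->
    forall z : Zp, A (x + p%:R ^+ (n + k) * of_Zp z).
  move=> An z; have := An (p%:R ^+ k * z).
  by rewrite exprD -mulrA /of_Zp rmorphM rmorphXn rmorph_nat.
move=> A B Ao Bo x [/Ao [n An] /Bo [k Bk]].
exists (n + k)%N => z; split; first exact: le_ball.
by rewrite addnC; exact: le_ball.
Qed.

Lemma padic_open_bigU (I : Type) (f : I -> set Qp) :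
  (forall i, padic_open (f i)) -> padic_open (\bigcup_i f i).
Proof.
move=> fo x [i _ fix_]; have [n fn] := fo i x fix_.
by exists n => z; exists i.
Qed.

HB.instance Definition _ := isOpenTopological.Build Qp
  padic_openT padic_openI padic_open_bigU.

(* Junk value 0 at x = 0. *)
Definition padic_ord (x : Qp) : int :=
  xget 0 [set n : int | exists2 u : Zp,
            u \is a GRing.unit & x = p%:R ^ n * of_Zp u].

Definition padic_abs (R : realType) (x : Qp) : R :=
  if x == 0 then 0 else p%:R ^ (- padic_ord x).

Definition padic_ac (x : Qp) : Qp := x / p%:R ^ padic_ord x.

(* [u 1] is the reduction of u modulo p, in [0, p). *)
Definition padic_positive (a : Qp) : Prop :=
  a != 0 /\ exists2 u : Zp, padic_ac a = of_Zp u & (1 <= u 1 <= p.-1./2)%N.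

(* Q_p^n with its Borel sigma-algebra. *)
Definition Qpn (n : nat) := g_sigma_algebraType (@open 'cV[Qp]_n).

Definition normalized_haar (R : realType) (n : nat)
    (mu : {measure set Qpn n -> \bar R}) : Prop :=
  (forall (a : 'cV[Qp]_n) (A : set (Qpn n)), measurable A ->
     mu [set a + x | x in (A : set 'cV[Qp]_n)] = mu A) /\
  mu [set x : 'cV[Qp]_n | forall i, range of_Zp (x i 0)] = 1%E.

Definition power_partial_sum (n : nat) (c : {ffun 'I_n -> nat} -> Qp)
    (h : 'cV[Qp]_n) (J : {fset {ffun 'I_n -> nat}}) : Qp :=
  \sum_(a <- J) c a * \prod_i h i 0 ^+ a i.

(* Near u0, f u is the unconditional sum of a power series in the coordinates
   of u - u0. *)
Definition analytic_at (n : nat) (f : 'cV[Qp]_n -> Qp) (u0 : 'cV[Qp]_n) :=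
  exists c : {ffun 'I_n -> nat} -> Qp, \forall u \near u0,
    power_partial_sum c (u - u0) @ totally --> f u.

Definition lorentz_form (x y : 'cV[Qp]_4) : Qp :=
  x 0 0 * y 0 0 - x 1 0 * y 1 0 - x 2 0 * y 2 0 - x 3 0 * y 3 0.

Definition lorentz_Q (x : 'cV[Qp]_4) : Qp := lorentz_form x x.

(* The partial derivative of Q with respect to k_l. *)
Definition lorentz_dQ (l : 'I_4) (k : 'cV[Qp]_4) : Qp :=
  (if l == 0 then 2 else -2) * k l 0.

Definition hyperboloid (m : Qp) : set 'cV[Qp]_4 :=
  [set k | lorentz_Q k = m ^+ 2].

(* V_{m^2}^+ for s = false and V_{m^2}^- for s = true. *)
Definition half_hyperboloid (m : Qp) (s : bool) : set 'cV[Qp]_4 :=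
  [set k | hyperboloid m k /\ padic_positive ((-1) ^+ s * k 0 0)].

(* The point of Q_p^4 with l-th coordinate t and other coordinates u. *)
Definition insert_coord (l : 'I_4) (t : Qp) (u : 'cV[Qp]_3) : 'cV[Qp]_4 :=
  \col_i (if unlift l i is Some j then u j 0 else t).

(* lam is the Gel'fand-Leray measure of V_{m^2}, seen as a Borel measure on
   Q_p^4 carried by V_{m^2}.  The 3-form lambda restricts to
   (+/-) dk_j /\ dk_j' /\ dk_j'' / (dQ/dk_l) on a piece of V_{m^2} which is
   the graph k_l = f(other coordinates) of an analytic function on an open set
   U and on which dQ/dk_l does not vanish. *)
Definition gelfand_leray (R : realType) (mu : {measure set Qpn 3 -> \bar R})
    (m : Qp) (lam : {measure set Qpn 4 -> \bar R}) : Prop :=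
  lam (~` hyperboloid m) = 0%E /\
  forall (l : 'I_4) (U : set 'cV[Qp]_3) (f : 'cV[Qp]_3 -> Qp),
    let chart u := insert_coord l (f u) u in
    open U ->
    (forall u, U u -> analytic_at f u) ->
    (forall u, U u -> hyperboloid m (chart u)) ->
    (forall u, U u -> lorentz_dQ l (chart u) != 0) ->
    forall A : set (Qpn 4), measurable A -> A `<=` chart @` U ->
      lam A = (\int[mu]_(u in U `&` chart @^-1` A)
                 ((padic_abs R (lorentz_dQ l (chart u)))^-1)%:E)%E.

Definition SOQ : set 'M[Qp]_4 :=
  [set L | [/\ L \in unitmx,
               forall x y, lorentz_form (L *m x) (L *m y) = lorentz_form x y &
               \det L = 1]].

Definition is_subgroup (H : set 'M[Qp]_4) : Prop :=
  [/\ H 1%:M, forall L M, H L -> H M -> H (L *m M) &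
      forall L, H L -> H (invmx L)].

Definition preserves_half_hyperboloids (m : Qp) (H : set 'M[Qp]_4) : Prop :=
  forall L, H L -> forall s,
    [set L *m k | k in half_hyperboloid m s] = half_hyperboloid m s.

(* L_+^up: the largest subgroup of SO(Q) preserving V_{m^2}^+ and V_{m^2}^-. *)
Definition restricted_lorentz (m : Qp) (G : set 'M[Qp]_4) : Prop :=
  let admissible H :=
    [/\ is_subgroup H, H `<=` SOQ & preserves_half_hyperboloids m H] in
  admissible G /\ forall H, admissible H -> H `<=` G.

(* The Schwartz-Bruhat space S(Q_p^4). *)
Definition test_function (R : realType) (phi : 'cV[Qp]_4 -> R[i]) : Prop :=
  (forall x, \forall y \near x, phi y = phi x) /\
  compact (closure [set x | phi x != 0]).

Definition delta (R : realType) (lam : {measure set Qpn 4 -> \bar R})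
    (m : Qp) (s : bool) (phi : 'cV[Qp]_4 -> R[i]) : R[i] :=
  Complex (\int[lam]_(k in half_hyperboloid m s) complex.Re (phi k))%R
          (\int[lam]_(k in half_hyperboloid m s) complex.Im (phi k))%R.

Definition GL_act (R : realType) (L : 'M[Qp]_4) (phi : 'cV[Qp]_4 -> R[i]) :
    'cV[Qp]_4 -> R[i] := fun x => phi (invmx L *m x).

Definition GL_act_distr (R : realType) (L : 'M[Qp]_4)
    (T : ('cV[Qp]_4 -> R[i]) -> R[i]) : ('cV[Qp]_4 -> R[i]) -> R[i] :=
  fun phi => T (GL_act (invmx L) phi).

(* Distributions are only evaluated on test functions. *)
Definition invariant_distr (R : realType) (G : set 'M[Qp]_4)
    (T : ('cV[Qp]_4 -> R[i]) -> R[i]) : Prop :=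
  forall L, G L -> forall phi, test_function phi -> GL_act_distr L T phi = T phi.

End Padic.

(* Main.v *)
From HB Require Import structures.
Require Import Defs.
From mathcomp Require Import all_boot all_order all_algebra.
From mathcomp Require Import finmap all_classical all_reals all_analysis.
From mathcomp Require Import generic_quotient fraction.
From mathcomp Require Import ring zify.

Set Implicit Arguments.
Unset Strict Implicit.
Unset Printing Implicit Defensive.

Import Order.TTheory GRing.Theory Num.Theory.

Local Open Scope classical_set_scope.
Local Open Scope ring_scope.

(** It suffices that the Gel'fand-Leray measure [lam] is invariant under every isometry
    of the form.  A reflection in a vector with vanishing [l]-th coordinate fixes the
    coordinate [k_l], so in the two charts [k_l = +/- sqrt (...)] it acts on the
    remaining three coordinates by a linear involution [g] which leaves the square
    root, hence the density, unchanged.  By uniqueness of Haar measure [g] scales it by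
    a constant [c] with [c ^ 2 = 1], so [c = 1] and the reflection preserves [lam].
    The part of the hyperboloid where [k_l = 0] is null, as seen in the other charts.
    The charts are analytic by the binomial series of [sqrt (1 + t)], which has p-adic
    integer coefficients because [p] is odd.  Finally these reflections generate the
    orthogonal group: an isometry is undone one basis vector at a time, after one
    reflection which makes a coordinate of the image of the first basis vector vanish. *)

(** * p-adic integers *)

(** [gelfand_leray] describes [lam] only on graphs over three of the coordinates, and a general
    isometry mixes these graphs; to treat it directly would take a change of variables for p-adic
    analytic maps. A reflection that keeps one coordinate stays within a single pair of graphs and
    is linear there, so Haar measure on a linear space suffices; being an involution, it needs no
    computation of a Jacobian. The price falls on the factorization of isometries: every vector to
    reflect in must lie in some coordinate hyperplane and must not be isotropic. When the difference
    of two vectors of equal nonzero norm is isotropic, their sum is not, because 2 is invertible. As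
    [m] is nonzero, the origin is off the hyperboloid, so the sheets of the four coordinates cover
    it. The group enters at the end: its elements are isometries, and they map the domain of
    integration onto itself. *)

Section PadicInteger.
Variables (p : nat) (p_pr : prime p).
Local Notation Zp := (padic_int p_pr).
Implicit Types x y z : Zp.

Lemma residue0 n : (0 : Zp) n = 0%N.
Proof. exact: mod0n. Qed.

Lemma residue_natr k n : (k%:R : Zp) n = (k %% p ^ n)%N.
Proof.
elim: k => [|k IHk]; first by rewrite residue0 mod0n.
by rewrite -natr1 -addn1 -modnDm -IHk.
Qed.

Lemma residueD x y n : (x + y) n = ((x n + y n) %% p ^ n)%N.
Proof. by []. Qed.

Lemma residueM x y n : (x * y) n = (x n * y n %% p ^ n)%N.
Proof. by []. Qed.

Lemma residue_lt x n : (x n < p ^ n)%N.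
Proof. by rewrite -residue_mod ltn_mod expn_gt0 prime_gt0. Qed.

Lemma residue_eq0_dvd x n : x n = 0%N -> exists y, x = p%:R ^+ n * y.
Proof.
move=> xn0; have pn_gt0 k : (0 < p ^ k)%N by rewrite expn_gt0 prime_gt0.
(* The quotient of [x] by [p ^ n] has [x (n + k) %/ p ^ n] as its residue modulo [p ^ k]. *)
have coh k : (x (n + k.+1) %/ p ^ n = x (n + k) %/ p ^ n %[mod p ^ k])%N.
  by rewrite !modn_divl -expnD (addnC k) addnS residue_coh residue_mod.
exists (padic_int_of p_pr coh); apply: padic_int_ext => k.
rewrite residueM /= -natrX residue_natr -(residue_coh_add x k n) (addnC k).
rewrite modnMml modnMmr mulnC divnK //.
by rewrite /dvdn residue_coh_add xn0.
Qed.

Lemma residue_eq_dvd x y n : x n = y n <-> exists z, x = y + p%:R ^+ n * z.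
Proof.
split=> [xy|[z ->]].
  have /residue_eq0_dvd[z xyz] : (x - y) n = 0%N.
    suff : (x - y) n = (y - y) n by rewrite subrr residue0.
    by rewrite /= xy.
  by exists z; rewrite -xyz addrC subrK.
by rewrite /= -natrX residue_natr modnn mul0n mod0n addn0 residue_mod.
Qed.

(** Each residue [x n] is coprime to [p ^ n], hence invertible there; inverses modulo [p ^ n] are
    unique, which makes the chosen ones coherent. *)
Lemma padic_int_unitE x : x 1%N != 0%N -> x \is a GRing.unit.
Proof.
move=> x1.
have co n : coprime (x n) (p ^ n).
  case: n => [|n]; first by rewrite coprimen1.
  rewrite coprimeXr // coprime_sym prime_coprime // /dvdn.
  by have := residue_coh_add x 1 n; rewrite expn1 add1n => ->.
have inv_ex n : exists k, (x n * k)%N = 1 %[mod p ^ n].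
  case: (posnP (x n)) => [x0|x_gt0].
    exists 0%N; have := co n; rewrite x0 /coprime gcd0n => /eqP ->.
    by rewrite !modn1.
  case: (egcdnP (p ^ n) x_gt0) => k l e _; exists k.
  by rewrite mulnC e (eqP (co n)) modnMDl.
have [f fP] := choice inv_ex.
have coh n : f n.+1 = f n %[mod p ^ n].
  have e : (x n * f n.+1)%N = 1 %[mod p ^ n].
    rewrite -residue_coh modnMml -(modn_dvdm _ (dvdn_exp2l p (leqnSn n))) fP.
    by rewrite modn_dvdm // dvdn_exp2l.
  rewrite -[f n.+1]mul1n -modnMml -(fP n) modnMml mulnAC mulnC.
  by rewrite -modnMmr e modnMmr muln1.
apply/unitrPr; exists (padic_int_of p_pr coh); apply: padic_int_ext => n.
by rewrite residueM /= modnMmr fP.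
Qed.

Lemma padic_int_factor x : x != 0 ->
  exists n (u : Zp), u 1%N != 0%N /\ x = p%:R ^+ n * u.
Proof.
(* The least index with a nonzero residue exceeds the valuation by one, since [x 0] is always
   zero. *)
move=> /padic_int_neq0 xn0; case: (ex_minnP xn0) => n xn nmin.
case: n => [|n] in xn nmin.
  by have := residue_lt x 0; rewrite expn0 ltnS leqn0 (negPf xn).
have /residue_eq0_dvd[u xu] : x n = 0%N.
  by apply/eqP; apply: contraT => /nmin; rewrite ltnn.
exists n, u; split=> //; apply: contra_neq xn => u1.
have [v uv] := residue_eq0_dvd u1.
rewrite xu uv mulrA -exprD addn1 -[RHS](residue0 n.+1).
by apply/residue_eq_dvd; exists v; rewrite add0r.
Qed.

Lemma padic_int_limit (s : nat -> Zp) :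
  (forall n, s n.+1 n = s n n) -> exists l : Zp, forall n, l n = s n n.
Proof.
move=> sP; have coh n : s n.+1 n.+1 = s n n %[mod p ^ n].
  by rewrite residue_coh residue_mod sP.
by exists (padic_int_of p_pr coh) => n; rewrite /= residue_mod.
Qed.

End PadicInteger.

(** * Square roots and the binomial series *)

Section PolySqrt.
Variables (R : comUnitRingType).

(** Truncated binomial series of the square root of [1 + X]. Adding [c *: 'X^n] changes the [n]-th
    coefficient of the square by [2 * c], so only divisions by 2 occur and integrality of the
    coefficients needs no separate proof. *)
Fixpoint sqrt1X (n : nat) : {poly R} :=
  if n is n'.+1 then
    sqrt1X n' + ((('X + 1)`_n - (sqrt1X n' ^+ 2)`_n) / 2%:R) *: 'X^n
  else 1.

Lemma sqrt1X_coef0 n : (sqrt1X n)`_0 = 1.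
Proof.
by elim: n => [|n IHn] /=; rewrite ?coef1 // coefD coefZ coefXn IHn mulr0 addr0.
Qed.

Lemma sqrt1X_sqr n k : (2%:R : R) \is a GRing.unit -> (k <= n)%N ->
  (sqrt1X n ^+ 2)`_k = ('X + 1)`_k.
Proof.
move=> u2; elim: n => [|n IHn] in k *.
  by rewrite leqn0 => /eqP ->; rewrite expr1n coefD coefX coef1 add0r.
move=> kn; rewrite [sqrt1X _]/=; set c := _ / _.
rewrite sqrrD -scalerAr exprZn -exprM !coefD !coefZ coefMXn coefXn.
(* The square of the correction term has degree [2 * n.+1], beyond the range of [k]. *)
have -> : (k == n.+1 * 2)%N = false by apply/negbTE; rewrite neq_ltn; lia.
rewrite mulr0 addr0; move: kn; rewrite leq_eqVlt ltnS => /predU1P[->|kn].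
  rewrite ltnn subnn sqrt1X_coef0 mulr1 -mulr2n -mulr_natr divrK //.
  by rewrite addrC subrK coefD.
by rewrite kn mulr0 !addr0 IHn // coefD.
Qed.

Lemma sqrt1X_horner_sqr n t : (2%:R : R) \is a GRing.unit ->
  exists q, (sqrt1X n).[t] ^+ 2 = 1 + t + t ^+ n.+1 * q.
Proof.
move=> u2; exists (drop_poly n.+1 (sqrt1X n ^+ 2 - ('X + 1))).[t].
have := poly_take_drop n.+1 (sqrt1X n ^+ 2 - ('X + 1)).
rewrite [take_poly _ _](_ : _ = 0); last first.
  apply/polyP => k; rewrite coef_take_poly coef0; case: ifP => // kn.
  by rewrite coefB sqrt1X_sqr // subrr.
move=> /(congr1 (horner^~ t)); rewrite add0r !hornerE => e.
by rewrite (mulrC (t ^+ _)) e; ring.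
Qed.

End PolySqrt.

Section BinomialSeries.
Variables (p : nat) (p_pr : prime p) (p_odd : p <> 2%N).
Local Notation Zp := (padic_int p_pr).

Lemma padic_int2_unit : (2%:R : Zp) \is a GRing.unit.
Proof.
have p_gt2 : (2 < p)%N by have := prime_gt1 p_pr; lia.
by apply: padic_int_unitE; rewrite residue_natr expn1 modn_small.
Qed.

Definition sqrt_coef (n : nat) : Zp := (sqrt1X Zp n)`_n.

Lemma sqrt1XE n : sqrt1X Zp n = \sum_(i < n.+1) sqrt_coef i *: 'X^i.
Proof.
elim: n => [|n IHn]; rewrite big_ord_recr /=.
  by rewrite big_ord0 add0r expr0 /sqrt_coef /= coef1 scale1r.
rewrite -IHn; congr (_ + _ *: _); rewrite /sqrt_coef /=; set c := _ / _.
rewrite coefD coefZ coefXn eqxx mulr1.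
by rewrite IHn -poly_def coef_poly ltnn add0r.
Qed.

(** The [n]-th term is divisible by [p ^ n], so the partial sums converge, and their squares agree
    with [1 + p%:R * s] to growing precision. The condition on [l 1] singles out one of the two
    roots. *)
Lemma sqrt_series s : exists l : Zp,
  [/\ l 1%N = 1%N, l ^+ 2 = 1 + p%:R * s &
      forall n, l n = (\sum_(i < n) sqrt_coef i * (p%:R * s) ^+ i) n].
Proof.
have sE n : (sqrt1X Zp n).[p%:R * s] = \sum_(i < n.+1) sqrt_coef i * (p%:R * s) ^+ i.
  by rewrite sqrt1XE horner_sum; apply: eq_bigr => i _; rewrite !hornerE.
pose S n : Zp := \sum_(i < n) sqrt_coef i * (p%:R * s) ^+ i.
have Sn n : S n.+1 n = S n n.
  apply/residue_eq_dvd; exists (sqrt_coef n * s ^+ n).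
  by rewrite /S big_ord_recr /= exprMn mulrCA.
have [l lS] := padic_int_limit Sn; exists l; split=> //.
  rewrite lS /S big_ord1 expr0 mulr1 /sqrt_coef coef1 residue_natr expn1.
  by rewrite modn_small // prime_gt1.
apply: padic_int_ext => n.
have [q qP] := sqrt1X_horner_sqr n (p%:R * s) padic_int2_unit.
rewrite expr2 residueM lS -/(S n) -Sn /S -sE -residueM -expr2 qP.
by apply/residue_eq_dvd; exists (p%:R * s ^+ n.+1 * q); rewrite exprMn exprSr; ring.
Qed.

End BinomialSeries.

(** * p-adic numbers and their topology *)

Lemma fraction_numden (R : idomainType) (x : {fraction R}) :
  exists a b : R, b != 0 /\ x = FracField.tofrac a / FracField.tofrac b.
Proof.
elim/quotW: x => r; exists r.1, r.2; have r2 := denom_ratioP r; split=> //.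
rewrite -[LHS](mulfK (x := FracField.tofrac r.2)) ?tofrac_eq0 //; congr (_ / _).
unlock FracField.tofrac; rewrite -[LHS]FracField.pi_mul.
apply/eqP; rewrite FracField.equivf_def /FracField.equivf /FracField.mulf.
by rewrite !numden_Ratio ?mulf_neq0 ?oner_neq0 // !mulr1 mulrC.
Qed.

Lemma mulB_expand (R : comPzRingType) (a b c d : R) :
  c * d - a * b = (c - a) * (d - b) + (c - a) * b + a * (d - b).
Proof. by ring. Qed.

Section PadicNumber.
Variables (p : nat) (p_pr : prime p).
Local Notation Zp := (padic_int p_pr).
Local Notation Qp := (padic p_pr).
Implicit Types (x y : Qp) (M N : int).

Lemma of_Zp_is_zmod_morphism : zmod_morphism (@of_Zp p p_pr).
Proof. exact: rmorphB. Qed.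

Lemma of_Zp_is_monoid_morphism : monoid_morphism (@of_Zp p p_pr).
Proof. by split; [exact: rmorph1 | exact: rmorphM]. Qed.

HB.instance Definition _ :=
  GRing.isZmodMorphism.Build Zp Qp (@of_Zp p p_pr) of_Zp_is_zmod_morphism.
HB.instance Definition _ :=
  GRing.isMonoidMorphism.Build Zp Qp (@of_Zp p p_pr) of_Zp_is_monoid_morphism.

Lemma of_Zp_inj : injective (@of_Zp p p_pr).
Proof. by move=> x y /eqP; rewrite /of_Zp tofrac_eq => /eqP. Qed.

Lemma padic_natr_neq0 k : (0 < k)%N -> (k%:R : Qp) != 0.
Proof.
move=> k_gt0; rewrite -(rmorph_nat (@of_Zp p p_pr)) -(rmorph0 (@of_Zp p p_pr)).
rewrite (inj_eq of_Zp_inj); apply/eqP => k0.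
have := residue_natr p_pr k k.
rewrite k0 residue0.
have kp : (k < p ^ k)%N by exact: ltn_expl (prime_gt1 p_pr).
rewrite modn_small //.
by move=> e; rewrite -e in k_gt0.
Qed.

Lemma padic_p_neq0 : (p%:R : Qp) != 0.
Proof. by rewrite padic_natr_neq0 // prime_gt0. Qed.

(** Estimates are phrased as membership in these subgroups instead of with [padic_abs]: the
    ultrametric inequality becomes closure under addition. *)
Definition pball (N : int) : set Qp :=
  [set x | exists z : Zp, x = p%:R ^ N * of_Zp z].

Lemma pball0 N : pball N 0.
Proof. by exists 0; rewrite rmorph0 mulr0. Qed.

Lemma pballD N x y : pball N x -> pball N y -> pball N (x + y).
Proof. by move=> [a ->] [b ->]; exists (a + b); rewrite rmorphD mulrDr. Qed.

Lemma pballN N x : pball N x -> pball N (- x).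
Proof. by move=> [a ->]; exists (- a); rewrite rmorphN mulrN. Qed.

Lemma pballBC N x y : pball N (x - y) -> pball N (y - x).
Proof. by move/pballN; rewrite opprB. Qed.

Lemma pballM M N x y : pball M x -> pball N y -> pball (M + N) (x * y).
Proof.
move=> [a ->] [b ->]; exists (a * b).
by rewrite rmorphM expfzDr ?padic_p_neq0 // mulrACA.
Qed.

Lemma pball_of_Zp (z : Zp) : pball 0 (of_Zp z).
Proof. by exists z; rewrite expr0z mul1r. Qed.

Lemma pball0E x : pball 0 x <-> range (@of_Zp p p_pr) x.
Proof.
split=> [[z ->]|[z _ <-]]; last exact: pball_of_Zp.
by exists z; rewrite ?expr0z ?mul1r.
Qed.

Lemma pball_natr k : pball 0 k%:R.
Proof. by rewrite -(rmorph_nat (@of_Zp p p_pr)); exact: pball_of_Zp. Qed.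

Lemma pball_exp N : pball N (p%:R ^ N).
Proof. by exists 1; rewrite rmorph1 mulr1. Qed.

Lemma pballW M N x : M <= N -> pball N x -> pball M x.
Proof.
rewrite -subr_ge0; case e: (N - M) => [k|//] _ Nx.
have -> : x = p%:R ^ (- k%:Z) * x * p%:R ^+ k.
  by rewrite mulrAC -exprnN mulVf ?mul1r // expf_neq0 // padic_p_neq0.
have -> : M = - k%:Z + N + 0 by rewrite -e; lia.
apply: pballM; first exact/pballM/Nx/pball_exp.
by rewrite -natrX; exact: pball_natr.
Qed.

Lemma pball_sum N (I : Type) (r : seq I) (P : pred I) (F : I -> Qp) :
  (forall i, P i -> pball N (F i)) -> pball N (\sum_(i <- r | P i) F i).
Proof. by move=> FN; elim/big_ind: _ => //; [exact: pball0 | exact: pballD]. Qed.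

Lemma pball_expM M N x : pball (M + N) (p%:R ^ M * x) <-> pball N x.
Proof.
split=> [[z e]|[z ->]]; exists z; last by rewrite mulrA expfzDr ?padic_p_neq0.
apply: (mulfI (expfz_neq0 M padic_p_neq0)).
by rewrite e mulrA expfzDr ?padic_p_neq0.
Qed.

Lemma pball_trans N x y z : pball N (x - y) -> pball N (y - z) -> pball N (x - z).
Proof. by move=> xy yz; rewrite -(subrKA y); exact: pballD. Qed.

Lemma of_Zp_eq_pball (a b : Zp) (n : nat) :
  a n = b n -> pball n (of_Zp a - of_Zp b).
Proof.
move=> /residue_eq_dvd[z ->]; exists z.
by rewrite rmorphD addrC addKr rmorphM rmorphXn rmorph_nat.
Qed.

Lemma padic_factor x : x != 0 ->
  exists N (u : Zp), u 1%N != 0%N /\ x = p%:R ^ N * of_Zp u.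
Proof.
have [a [b [b0 ->]]] := fraction_numden x => ab0.
have a0 : a != 0 by apply: contraNneq ab0 => ->; rewrite rmorph0 mul0r.
have [k [u [u1 ->]]] := padic_int_factor a0.
have [l [v [v1 ->]]] := padic_int_factor b0.
have uv := padic_int_unitE v1; exists (k%:Z - l%:Z), (u / v); split.
  by apply: contra_neq u1 => uv0; rewrite -[u](divrK uv) residueM uv0 mul0n mod0n.
rewrite -/(of_Zp _) -/(of_Zp _) !rmorphM !rmorphXn !rmorph_nat rmorphV //.
by rewrite expfzDr ?padic_p_neq0 // -exprnN invfM mulrACA.
Qed.

Lemma pball_ex x : exists n : nat, pball (- n%:Z) x.
Proof.
have [->|/padic_factor[N [u [_ ->]]]] := eqVneq x 0.
  by exists 0%N; exact: pball0.
exists `|N|%N; apply: (@pballW _ N); first by lia.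
by exists u.
Qed.

Lemma padic_not_pball x : x != 0 -> exists n : nat, ~ pball n x.
Proof.
move=> /padic_factor[N [u [/eqP u1 ->]]]; exists `|N|.+1%N => xn; apply: u1.
have : pball (N + 1) (p%:R ^ N * of_Zp u) by apply: pballW xn; lia.
rewrite pball_expM => -[z]; rewrite -exprnP expr1 -(rmorph_nat (@of_Zp p p_pr)).
rewrite -rmorphM => /of_Zp_inj uz; rewrite -[RHS](residue0 p_pr 1).
by apply/residue_eq_dvd; exists z; rewrite add0r expr1.
Qed.

Lemma nbhs_padicE x (A : set Qp) :
  nbhs x A <-> exists n : nat, forall y, pball n (y - x) -> A y.
Proof.
split=> [[B [Bo Bx BA]]|[n nA]].
  have [n nB] := Bo _ Bx; exists n => y [z yx]; apply: BA.
  by rewrite -(subrK x y) addrC yx.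
exists [set y | pball n (y - x)]; split=> [y yx||y /nA //].
  exists n => z /=; apply: pball_trans yx; rewrite addrAC subrr add0r; exists z.
  by [].
by rewrite /= subrr; exact: pball0.
Qed.

Lemma nbhs_padic_colE n (x : 'cV[Qp]_n) (A : set 'cV[Qp]_n) :
  nbhs x A <->
  exists N : nat, forall y : 'cV[Qp]_n, (forall i, pball N (y i 0 - x i 0)) -> A y.
Proof.
split=> [[P xP PA]|[N NA]].
  have /choice[f fP] : forall i, exists k : nat,
      forall y, pball k (y - x i 0) -> P i 0 y.
    by move=> i; apply/nbhs_padicE.
  exists (\max_i f i)%N => y yx; apply: PA => i j; rewrite ord1.
  by apply: fP; apply: pballW (yx i); rewrite lez_nat leq_bigmax.
exists (fun i _ => [set y | pball N (y - x i 0)]) => [i j|y yx].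
  by rewrite ord1; apply/nbhs_padicE; exists N.
by apply: NA => i; exact: yx.
Qed.

Lemma open_padic_colE n (A : set 'cV[Qp]_n) :
  open A <-> forall x : 'cV[Qp]_n, A x ->
  exists N : nat, forall y : 'cV[Qp]_n, (forall i, pball N (y i 0 - x i 0)) -> A y.
Proof.
rewrite openE; split=> Ao x Ax; first by apply/nbhs_padic_colE; exact: Ao.
by apply/nbhs_padic_colE; exact: Ao.
Qed.

Lemma padic_near_pball (T : topologicalType) (f : T -> Qp) (N : nat) (x : T) :
  continuous f -> \forall y \near x, pball N (f y - f x).
Proof.
move=> fc; apply: (fc x [set z | pball N (z - f x)]).
by apply/nbhs_padicE; exists N.
Qed.

Lemma padic_continuousP (T : topologicalType) (f : T -> Qp) :
  (forall (x : T) (N : nat), \forall y \near x, pball N (f y - f x)) -> continuous f.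
Proof.
move=> fN x A /nbhs_padicE[N NA].
by apply: filterS (fN x N) => y; exact: NA.
Qed.

Lemma padic_continuousD (T : topologicalType) (f g : T -> Qp) :
  continuous f -> continuous g -> continuous (f \+ g).
Proof.
move=> fc gc; apply: padic_continuousP => x N.
apply: (filterS2 _ _ (padic_near_pball N x fc) (padic_near_pball N x gc)) => y fy gy.
by rewrite /= opprD addrACA; exact: pballD.
Qed.

Lemma padic_continuousM (T : topologicalType) (f g : T -> Qp) :
  continuous f -> continuous g -> continuous (f \* g).
Proof.
move=> fc gc; apply: padic_continuousP => x N.
have [k kf] := pball_ex (f x); have [l lg] := pball_ex (g x).
apply: (filterS2 _ _ (padic_near_pball (N + l) x fc)
  (padic_near_pball (N + k) x gc)).
move=> y fy gy /=.
rewrite mulB_expand.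
apply: pballD; first apply: pballD.
- by apply: pballW (pballM fy gy); lia.
- by apply: pballW (pballM fy lg); lia.
- by apply: pballW (pballM kf gy); lia.
Qed.

Lemma padic_continuous_coord n i : continuous (fun x : 'cV[Qp]_n => x i 0).
Proof.
move=> x A /nbhs_padicE[N NA]; apply/nbhs_padic_colE.
by exists N => y yx; exact: NA.
Qed.

Lemma padic_continuous_sum (T : topologicalType) (I : Type) (r : seq I)
    (f : I -> T -> Qp) :
  (forall i, continuous (f i)) -> continuous (fun t => \sum_(i <- r) f i t).
Proof.
move=> fc; elim: r => [|i r IHr].
  by under eq_fun do rewrite big_nil; exact: cst_continuous.
by under eq_fun do rewrite big_cons; exact: padic_continuousD.
Qed.

Lemma padic_mulmx_continuous m n (L : 'M[Qp]_(m, n)) :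
  continuous (fun x : 'cV[Qp]_n => L *m x).
Proof.
move=> x A /nbhs_padic_colE[N NA].
pose f i (y : 'cV[Qp]_n) := (L *m y) i 0.
have fc i : continuous (f i).
  rewrite /f; under eq_fun do rewrite mxE; apply: padic_continuous_sum => j.
  apply: padic_continuousM; [exact: cst_continuous|exact: padic_continuous_coord].
have : \forall y \near x, forall i, pball N (f i y - f i x).
  exact: (filter_forall _ (fun i => padic_near_pball N x (fc i))).
by apply: filterS => y; exact: NA.
Qed.

End PadicNumber.

(** * Selecting a square root by its leading digit *)

Section PadicHalf.
Variables (p : nat) (p_pr : prime p) (p_odd : p <> 2%N).
Local Notation Zp := (padic_int p_pr).
Local Notation Qp := (padic p_pr).
Implicit Types (a b : Qp).

(* One of the two square roots of a square is singled out by its leading digit. *)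
Definition padic_half : set Qp :=
  [set a | exists N (u : Zp), (0 < u 1 <= p.-1./2)%N /\ a = p%:R ^ N * of_Zp u].

Lemma padic_halfM a (y : Zp) : y 1%N = 1%N -> padic_half a ->
  padic_half (a * of_Zp y).
Proof.
move=> y1 [N [u [u1 ->]]]; exists N, (u * y); split; last by rewrite rmorphM mulrA.
by have := residue_mod u 1; rewrite residueM y1 muln1 => ->.
Qed.

Lemma padic_half_cover a : a != 0 -> padic_half a \/ padic_half (- a).
Proof.
move=> /padic_factor[N [u [u1 ->]]].
have u1p := residue_lt u 1; rewrite expn1 in u1p.
have [le_u|lt_u] := leqP (u 1%N) p.-1./2.
  by left; exists N, u; rewrite lt0n u1 le_u.
right; exists N, (- u); rewrite rmorphN mulrN; split=> //.
have nu1p := residue_lt (- u) 1; rewrite expn1 in nu1p.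
(* The leading digits of [u] and [- u] add up to [p], which is odd, so one of them is at most
   [p.-1./2]. *)
have : ((u 1%N + (- u) 1%N) %% p)%N = 0%N.
  by have := residueD u (- u) 1; rewrite addrN residue0 expn1.
have [lt_p|le_p] := ltnP (u 1%N + (- u) 1%N) p; first by rewrite modn_small //; lia.
rewrite -(subnKC le_p) modnDl modn_small; last by lia.
by have [//|] := even_prime p_pr; lia.
Qed.

(** Divided by the lower power of [p], a vanishing sum reads [u + p ^ k * v = 0]. Modulo [p] its
    left side is [u 1 + v 1], which lies strictly between 0 and [p], if [k = 0], and the nonzero
    digit [u 1] otherwise. *)
Lemma padic_half_disjoint a : padic_half a -> ~ padic_half (- a).
Proof.
have p_gt1 := prime_gt1 p_pr.
have le_absurd (M N : int) (u v : Zp) : M <= N ->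
    (0 < u 1 <= p.-1./2)%N -> (0 < v 1 <= p.-1./2)%N ->
    p%:R ^ M * of_Zp u + p%:R ^ N * of_Zp v = 0 -> False.
  rewrite -subr_ge0; case e: (N - M) => [k|//] _ u1 v1.
  have -> : N = M + k by rewrite -e; lia.
  rewrite expfzDr ?padic_p_neq0 // -mulrA -mulrDr => /eqP.
  rewrite mulf_eq0 expfz_eq0 (negPf (padic_p_neq0 _)) andbF /= => /eqP.
  rewrite -exprnP -(rmorph_nat (@of_Zp p p_pr)) -rmorphXn -rmorphM -rmorphD.
  rewrite -[RHS](rmorph0 (@of_Zp p p_pr)) => /of_Zp_inj.
  move=> uv0; have : ((u 1%N + (p%:R ^+ k * v)%R 1%N) %% p)%N = 0%N.
    by have := residueD u (p%:R ^+ k * v) 1; rewrite uv0 residue0 expn1.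
  case: k {e uv0} => [|k].
    by rewrite expr0 mul1r modn_small; lia.
  have -> : (p%:R ^+ k.+1 * v : Zp) 1%N = 0%N.
    by rewrite -natrX residueM residue_natr expn1 expnS modnMr mul0n mod0n.
  by rewrite addn0 modn_small; lia.
move=> [M [u [u1 ->]]] [N [v [v1 /eqP]]]; rewrite eq_sym -addr_eq0 => /eqP.
have [MN|/ltW NM] := leP M N; first by rewrite addrC; exact: le_absurd.
exact: le_absurd.
Qed.

Lemma padic_half_sqr_inj a b : padic_half a -> padic_half b ->
  a ^+ 2 = b ^+ 2 -> a = b.
Proof.
move=> ha hb /eqP; rewrite eqf_sqr => /orP[/eqP //|/eqP ab].
by case: (padic_half_disjoint hb); rewrite -ab.
Qed.

Lemma padic_halfMD a t : pball 1 t -> padic_half a -> padic_half (a * (1 + t)).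
Proof.
move=> [z ->]; have -> : 1 + p%:R ^ 1 * of_Zp z = of_Zp (1 + p%:R * z).
  by rewrite rmorphD rmorph1 rmorphM rmorph_nat.
apply: padic_halfM; have : exists y : Zp, 1 + p%:R * z = 1 + p%:R ^+ 1 * y.
  by exists z.
move=> /residue_eq_dvd ->; apply: etrans (residue_natr p_pr 1 1) _.
by rewrite expn1 modn_small // prime_gt1.
Qed.

Lemma padic_half_open a : padic_half a ->
  exists n : nat, forall b, pball n (b - a) -> padic_half b.
Proof.
(* Zero is its own opposite, so it would lie in both halves. *)
move=> ha; have a0 : a != 0.
  by apply/eqP => a0; apply: (padic_half_disjoint ha); rewrite a0 oppr0 -a0.
have [k ka] := pball_ex a^-1; exists (k + 1)%N => b ba.
have -> : b = a * (1 + a^-1 * (b - a)) by rewrite mulrDr mulr1 mulVKf // addrC subrK.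
by apply: padic_halfMD ha; apply: pballW (pballM ka ba); lia.
Qed.

End PadicHalf.

(** * Power series in several variables *)

Section SeriesOfPolynomial.
Variables (F : comNzRingType) (d : nat) (I : finType).
Variables (k : I -> F) (e : I -> {ffun 'I_d -> nat}) (b : nat -> F).

Definition mon (a : {ffun 'I_d -> nat}) (h : 'cV[F]_d) : F :=
  \prod_j h j 0 ^+ a j.

Definition mdeg (a : {ffun 'I_d -> nat}) : nat := (\sum_j a j)%N.

(** A word picks one monomial from each factor of the [n]-th power of the polynomial; this is the
    exponent of the product. *)
Definition word_exp n (w : {ffun 'I_n -> I}) : {ffun 'I_d -> nat} :=
  [ffun j => (\sum_i e (w i) j)%N].

Definition word_term (h : 'cV[F]_d) n (w : {ffun 'I_n -> I}) : F :=
  b n * \prod_i (k (w i) * mon (e (w i)) h).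

(* Expanding each power of the polynomial, the coefficient at [a] of the series
   [\sum_n b n * (\sum_i k i * mon (e i) h) ^+ n]. *)
Definition series_coef (a : {ffun 'I_d -> nat}) : F :=
  \sum_(n < (mdeg a).+1) b n *
    \sum_(w : {ffun 'I_n -> I} | word_exp w == a) \prod_i k (w i).

Lemma mon_word_exp n (w : {ffun 'I_n -> I}) h :
  mon (word_exp w) h = \prod_i mon (e (w i)) h.
Proof.
rewrite /mon exchange_big /=; apply: eq_bigr => j _.
by rewrite ffunE expr_sum.
Qed.

Lemma series_coef_mon a h : series_coef a * mon a h =
  \sum_(n < (mdeg a).+1) \sum_(w : {ffun 'I_n -> I} | word_exp w == a)
    word_term h w.
Proof.
rewrite mulr_suml; apply: eq_bigr => n _; rewrite mulrAC -mulrA !mulr_sumr.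
apply: eq_bigr => w /eqP wa; have -> : mon a h = mon (word_exp w) h by rewrite wa.
by rewrite mon_word_exp /word_term big_split /=; congr (_ * _); exact: mulrC.
Qed.

Lemma sum_word_term n h :
  b n * (\sum_i k i * mon (e i) h) ^+ n = \sum_(w : {ffun 'I_n -> I}) word_term h w.
Proof.
rewrite -mulr_sumr -(bigA_distr_bigA (fun (_ : 'I_n) i => k i * mon (e i) h)).
by rewrite prodr_const card_ord.
Qed.

Hypothesis e_gt0 : forall i, exists j, (0 < e i j)%N.

(** Without constant term, powers beyond [mdeg a] cannot contribute to exponent [a]; this justifies
    the finite range of the sum in [series_coef]. *)
Lemma mdeg_word_exp n (w : {ffun 'I_n -> I}) : (n <= mdeg (word_exp w))%N.
Proof.
rewrite /mdeg; under eq_bigr do rewrite ffunE.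
rewrite exchange_big /= -[leqLHS]card_ord -sum1_card leq_sum // => i _.
have [j ej] := e_gt0 (w i); rewrite (bigD1 j) //=; lia.
Qed.

End SeriesOfPolynomial.

Section PadicSeries.
Variables (p : nat) (p_pr : prime p) (p_odd : p <> 2%N).
Local Notation Zp := (padic_int p_pr).
Local Notation Qp := (padic p_pr).

Lemma pball_prod (I : finType) (F : I -> Qp) :
  (forall i, pball 1 (F i)) -> pball #|I| (\prod_i F i).
Proof.
move=> F1; rewrite -sum1_card -natz natr_sum.
elim/big_ind2: _ => // [|m x n y]; [exact: (pball_natr p_pr 1)|exact: pballM].
Qed.

Variables (d : nat) (I : finType).
Variables (k : I -> Qp) (e : I -> {ffun 'I_d -> nat}) (b : nat -> Zp).
Hypothesis e_gt0 : forall i, exists j, (0 < e i j)%N.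

Local Notation ser := (series_coef k e (@of_Zp p p_pr \o b)).
Local Notation term := (word_term k e (@of_Zp p p_pr \o b)).

(** A word of length [n] contributes a term in [p ^ n Z_p], so modulo [p ^ N] only the finitely many
    words shorter than [N] matter. Once [J] contains all their exponents, the sum over [J] is the
    [N]-th partial sum of the one-variable series modulo [p ^ N]. *)
Lemma series_coef_cvg (h : 'cV[Qp]_d) (l : Qp) :
  (forall i, pball 1 (k i * mon (e i) h)) ->
  (forall n : nat, pball n
     (l - \sum_(i < n) of_Zp (b i) * (\sum_i k i * mon (e i) h) ^+ i)) ->
  forall N : nat, exists J0 : {fset {ffun 'I_d -> nat}}, forall J,
    (J0 `<=` J)%fset -> pball N (\sum_(a <- J) ser a * mon a h - l).
Proof.
move=> h1 lN N.
have term_ball n (w : {ffun 'I_n -> I}) : pball n (term h w).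
  rewrite -[n%:Z]add0r; apply: pballM; first exact: pball_of_Zp.
  by have := pball_prod (fun i => h1 (w i)); rewrite card_ord.
pose words :=
  flatten [seq [seq word_exp e w | w : {ffun 'I_n -> I}] | n <- iota 0 N].
exists [fset a in words]%fset => J wJ.
have {wJ}wJ n (w : {ffun 'I_n -> I}) : (n < N)%N -> word_exp e w \in J.
  move=> nN; apply: (fsubsetP wJ); rewrite inE; apply/flatten_mapP.
  by exists n; [rewrite mem_iota|apply: map_f; rewrite mem_enum].
pose T n a := \sum_(w : {ffun 'I_n -> I} | word_exp e w == a) term h w.
have T_ball (n : nat) a : pball n (T n a) by exact: pball_sum.
have T0 n a : (mdeg a < n)%N -> T n a = 0.
  move=> an; rewrite /T big_pred0 // => w; apply: contraTF an => /eqP <-.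
  by rewrite -leqNgt mdeg_word_exp.
(* The two ranges differ by lengths above [mdeg a], whose terms vanish, or by lengths at least [N],
   whose terms are small. *)
have trunc a : pball N (ser a * mon a h - \sum_(n < N) T n a).
  rewrite series_coef_mon -!(big_mkord xpredT (T ^~ a)).
  have [aN|Na] := ltnP (mdeg a) N.
    rewrite (@big_cat_nat _ _ _ (mdeg a).+1 0 N) //= opprD addrA subrr add0r.
    apply: pballN; rewrite big_nat; apply: pball_sum => n /andP[an _].
    by rewrite T0 //; exact: pball0.
  rewrite (@big_cat_nat _ _ _ N 0 (mdeg a).+1) //= ?leqW // addrAC subrr add0r.
  rewrite big_nat; apply: pball_sum => n /andP[Nn _].
  by apply: pballW (T_ball n a); rewrite lez_nat.
apply: (@pball_trans _ _ _ _ (\sum_(a <- J) \sum_(n < N) T n a)).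
  by rewrite -sumrB; apply: pball_sum => a _; exact: trunc.
apply: pballBC; rewrite exchange_big /=.
rewrite [X in _ - X](_ : _ =
  \sum_(i < N) of_Zp (b i) * (\sum_i k i * mon (e i) h) ^+ i); first exact: lN.
apply: eq_bigr => n _; rewrite [RHS](sum_word_term k e (@of_Zp p p_pr \o b)) /T.
rewrite (exchange_big_dep xpredT) //=; apply: eq_bigr => w _.
(* [J] has no repetitions and contains [word_exp e w], so each word is counted exactly once. *)
under eq_bigl do rewrite eq_sym.
by rewrite -big_filter filter_pred1_uniq ?fset_uniq ?wJ // big_seq1.
Qed.

End PadicSeries.

(** * Continuity and analyticity of square roots *)

Section PadicSqrt.
Variables (p : nat) (p_pr : prime p) (p_odd : p <> 2%N).
Local Notation Zp := (padic_int p_pr).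
Local Notation Qp := (padic p_pr).

Lemma padic_continuousX (T : topologicalType) (f : T -> Qp) n :
  continuous f -> continuous (fun t => f t ^+ n).
Proof.
move=> fc; elim: n => [|n IHn].
  by under eq_fun do rewrite expr0; exact: cst_continuous.
by under eq_fun do rewrite exprS; exact: padic_continuousM.
Qed.

Lemma padic_continuous_prod (T : topologicalType) (I : Type) (r : seq I)
    (f : I -> T -> Qp) :
  (forall i, continuous (f i)) -> continuous (fun t => \prod_(i <- r) f i t).
Proof.
move=> fc; elim: r => [|i r IHr].
  by under eq_fun do rewrite big_nil; exact: cst_continuous.
by under eq_fun do rewrite big_cons; exact: padic_continuousM.
Qed.

Lemma near_mon_small d (e : {ffun 'I_d -> nat}) (k : Qp) (u0 : 'cV[Qp]_d) :
  (exists j, (0 < e j)%N) ->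
  \forall u \near u0, pball 1 (k * mon e (u - u0)).
Proof.
move=> [j ej].
have mc : continuous (fun u : 'cV[Qp]_d => k * mon e (u - u0)).
  apply: padic_continuousM; first exact: cst_continuous.
  apply: padic_continuous_prod => i; apply: padic_continuousX.
  under eq_fun do rewrite !mxE.
  by apply: padic_continuousD; [exact: padic_continuous_coord|exact: cst_continuous].
apply: filterS (padic_near_pball 1 u0 mc) => u.
rewrite [X in _ - k * X](_ : _ = 0) ?mulr0 ?subr0 //.
by rewrite /mon (bigD1 j) //= subrr mxE expr0n eqn0Ngt ej mul0r.
Qed.

Lemma sqrt1D_padic (t : Qp) : pball 1 t ->
  exists l : Zp, [/\ l 1%N = 1%N, of_Zp l ^+ 2 = 1 + t & forall n : nat,
    pball n (of_Zp l - \sum_(i < n) of_Zp (sqrt_coef p_pr i) * t ^+ i)].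
Proof.
move=> [s ->]; have [l [l1 l2 lN]] := sqrt_series p_odd s.
exists l; split=> //.
  by rewrite -rmorphXn l2 rmorphD rmorphM rmorph_nat rmorph1.
move=> n; rewrite [X in _ - X](_ : _ =
  of_Zp (\sum_(i < n) sqrt_coef p_pr i * (p%:R * s) ^+ i)).
  exact: of_Zp_eq_pball.
rewrite rmorph_sum; apply: eq_bigr => i _.
by rewrite rmorphM rmorphXn rmorphM rmorph_nat.
Qed.

Lemma padic_half_sqrt (a t : Qp) : padic_half a -> pball 1 t ->
  exists2 b, padic_half b & b ^+ 2 = a ^+ 2 * (1 + t).
Proof.
move=> ha /sqrt1D_padic[l [l1 l2 _]]; exists (a * of_Zp l).
  exact: padic_halfM.
by rewrite exprMn l2.
Qed.

(** On one sheet, [f u] is [f u0] times the binomial series evaluated at a polynomial in [u - u0]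
    without constant term. The factor [c] records the sheet on which [f] lies. *)
Lemma analytic_at_sqrt d (I : finType) (k : I -> Qp)
    (e : I -> {ffun 'I_d -> nat}) (f : 'cV[Qp]_d -> Qp) (c : Qp) (u0 : 'cV[Qp]_d) :
  c != 0 -> (forall i, exists j, (0 < e i j)%N) ->
  (\forall u \near u0, padic_half (c * f u) /\
    f u ^+ 2 = f u0 ^+ 2 * (1 + \sum_i k i * mon (e i) (u - u0))) ->
  analytic_at f u0.
Proof.
move=> c0 e_gt0 fP; have [hf0 _] := nbhs_singleton fP.
exists (fun a => f u0 * series_coef k e (@of_Zp p p_pr \o sqrt_coef p_pr) a).
have small : \forall u \near u0, forall i, pball 1 (k i * mon (e i) (u - u0)).
  exact: (filter_forall _ (fun i => near_mon_small (k i) u0 (e_gt0 i))).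
apply: (filterS2 _ _ fP small) => u [hf f2] h1.
have [|l [l1 l2 lN]] := @sqrt1D_padic (\sum_i k i * mon (e i) (u - u0)).
  exact: pball_sum.
(* Both sides have the same square and, after multiplication by [c], lie in the same half. *)
have -> : f u = f u0 * of_Zp l.
  apply: (mulfI c0); apply: (padic_half_sqr_inj p_odd hf).
    by rewrite mulrA; exact: padic_halfM.
  by rewrite [LHS]exprMn [RHS]exprMn f2 exprMn l2.
move=> A /nbhs_padicE[N NA]; have [m fm] := pball_ex (f u0).
(* The factor [f u0] lies in [p ^ (- m) Z_p] and costs [m] digits of precision. *)
have [J0 J0P] := series_coef_cvg e_gt0 h1 lN (m + N).
exists J0 => // J /J0P J0J; apply: NA.
have -> : power_partial_sum
    (fun a => f u0 * series_coef k e (@of_Zp p p_pr \o sqrt_coef p_pr) a)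
    (u - u0) J = f u0 * \sum_(a <- J)
    series_coef k e (@of_Zp p p_pr \o sqrt_coef p_pr) a * mon a (u - u0).
  by rewrite mulr_sumr; apply: eq_bigr => a _; rewrite mulrA.
by rewrite -mulrBr; have := pballM fm J0J; rewrite PoszD addKr.
Qed.

End PadicSqrt.

(** * Measure-preserving bijections *)

Section MeasurePreserving.
Context d (T : measurableType d) (R : realType).
Variable mu : {measure set T -> \bar R}.

Definition measure_preserving (g : T -> T) : Prop :=
  measurable_fun setT g /\ forall A, measurable A -> mu (g @^-1` A) = mu A.

Lemma measure_preserving_preimage (g : T -> T) A :
  measure_preserving g -> measurable A -> measurable (g @^-1` A).
Proof. by move=> [mg _] mA; rewrite -[_ @^-1` _]setTI; exact: mg. Qed.

Lemma measure_preserving_comp (g h : T -> T) :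
  measure_preserving g -> measure_preserving h -> measure_preserving (g \o h).
Proof.
move=> gP hP; split; first exact: measurableT_comp (proj1 gP) (proj1 hP).
move=> A mA; rewrite comp_preimage (proj2 hP) ?(proj2 gP) //.
exact: measure_preserving_preimage.
Qed.

Lemma measure_preserving_inv (g h : T -> T) : cancel g h ->
  measurable_fun setT h -> measure_preserving g -> measure_preserving h.
Proof.
move=> gK mh [mg gP]; split=> // A mA.
rewrite -gP; last by rewrite -[_ @^-1` _]setTI; exact: mh.
by rewrite -comp_preimage (_ : h \o g = id) // funeqE => x /=.
Qed.

Import HBNNSimple.

Section NonnegSimpleComp.
Variables (g : T -> T) (mg : measurable_fun setT g) (h : {nnsfun T >-> R}).

Definition simple_comp := fun x => h (g x).

Let simple_comp_measurable : measurable_fun setT simple_comp.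
Proof. exact: (measurableT_comp (measurable_funPT h) mg). Qed.

Let simple_comp_finite : finite_set (range simple_comp).
Proof. by apply: (@sub_finite_set _ _ (range h)) => // _ [x _ <-]; exists (g x). Qed.

Let simple_comp_ge0 x : 0 <= simple_comp x.
Proof. exact: fun_ge0. Qed.

#[local] HB.instance Definition _ :=
  isMeasurableFun.Build _ _ T R simple_comp simple_comp_measurable.
#[local] HB.instance Definition _ :=
  @FiniteImage.Build T R simple_comp simple_comp_finite.
#[local] HB.instance Definition _ :=
  @isNonNegFun.Build T R simple_comp simple_comp_ge0.

Definition nnsfun_comp : {nnsfun T >-> R} := simple_comp.

End NonnegSimpleComp.

(** Composition with [g] takes a simple function below [F] to one below [F \o g], and its level sets
    keep their measure. The converse inequality will come from the inverse of [g]. *)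
Let le_nnintegral_comp (g : T -> T) (F : T -> \bar R) : measure_preserving g ->
  (ereal_sup [set sintegral mu h |
     h in [set h : {nnsfun T >-> R} | forall x, ((h x)%:E <= F x)%E]] <=
   ereal_sup [set sintegral mu h |
     h in [set h : {nnsfun T >-> R} | forall x, ((h x)%:E <= F (g x))%E]])%E.
Proof.
move=> gP; apply: ge_ereal_sup => _ [h /= hF <-]; apply: ereal_sup_ubound.
exists (nnsfun_comp (proj1 gP) h) => [x|]; first exact: hF.
rewrite !sintegralET; apply: eq_fsbigr => r _; congr (_ * _)%E.
exact: (proj2 gP _ (measurable_funPTI h (measurable_set1 r))).
Qed.

(* The simple functions below [f] are transported by [g]. *)
Lemma integral_measure_preserving (g h : T -> T) (D : set T) (f : T -> \bar R) :
  cancel g h -> cancel h g -> measurable_fun setT h -> measure_preserving g ->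
  (\int[mu]_(x in g @^-1` D) f (g x) = \int[mu]_(x in D) f x)%E.
Proof.
move=> gK hK mh gP; have hP := measure_preserving_inv gK mh gP.
have eq_nn (F : T -> \bar R) :
   ereal_sup [set sintegral mu h |
     h in [set h : {nnsfun T >-> R} | forall x, ((h x)%:E <= F (g x))%E]] =
   ereal_sup [set sintegral mu h |
     h in [set h : {nnsfun T >-> R} | forall x, ((h x)%:E <= F x)%E]].
  apply/eqP; rewrite eq_le le_nnintegral_comp // andbT.
  have := le_nnintegral_comp (F \o g) hP.
  by congr (_ <= ereal_sup [set _ | _ in _])%E; apply/seteqP; split=> k kF x;
    have := kF x; rewrite /= hK.
rewrite /integral.
have -> : (fun x => f (g x)) \_ (g @^-1` D) = (f \_ D) \o g.
  by apply/funext => x; rewrite /= !patchE; congr (if _ then _ else _);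
    apply/idP/idP; rewrite !inE.
have pos : (f \_ D \o g)^\+%E = (f \_ D)^\+%E \o g.
  by apply/funext => x; rewrite /= !funeposE.
have neg : (f \_ D \o g)^\-%E = (f \_ D)^\-%E \o g.
  by apply/funext => x; rewrite /= !funenegE.
by rewrite pos neg; congr (_ - _)%E; [exact: (eq_nn _)|exact: (eq_nn _)].
Qed.

Lemma integral_null_set (N D : set T) (f : T -> \bar R) :
  measurable N -> mu N = 0%E -> D `<=` N -> (forall x, D x -> 0 <= f x)%E ->
  (\int[mu]_(x in D) f x = 0)%E.
Proof.
move=> mN N0 DN f0; apply/eqP; rewrite eq_le integral_ge0 // andbT.
rewrite ge0_integralE //; apply: ge_ereal_sup => _ [h /= hf <-].
rewrite sintegralET fsbig1 // => r _.
(* Off [D] the integrand is 0, so a level set of [h] at [r != 0] lies in [D], hence in the null set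
   [N]. *)
have [->|r0] := eqVneq r 0; first by rewrite mul0e.
rewrite (subset_measure0 (measurable_funPTI h (measurable_set1 r)) mN _ N0).
  exact: mule0.
move=> x /= hx; apply: DN; have := hf x; rewrite patchE hx; case: ifP.
  by rewrite inE.
have : 0 <= h x := fun_ge0 x; rewrite hx lee_fin => r_ge0 _ r_le0.
by move: r0; rewrite eq_le r_ge0 r_le0.
Qed.

End MeasurePreserving.

(** * Haar measure on Q_p^n *)

Section Haar.
Variables (p : nat) (p_pr : prime p) (n : nat).
Local Notation Zp := (padic_int p_pr).
Local Notation Qp := (padic p_pr).
Local Notation V := 'cV[Qp]_n.
Local Notation T := (Qpn p_pr n).

Lemma pball_approx (N : int) (k : nat) (x : Qp) : pball N x ->
  exists r : 'I_(p ^ k), pball (N + k) (x - p%:R ^ N * r%:R).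
Proof.
move=> [z ->]; exists (Ordinal (residue_lt z k)) => /=.
rewrite -mulrBr pball_expM -(rmorph_nat (@of_Zp p p_pr)).
by apply: of_Zp_eq_pball; rewrite residue_natr residue_mod.
Qed.

Lemma padic_natr_inj (r s : nat) : r%:R = s%:R :> Qp -> r = s.
Proof.
wlog rs : r s / (r <= s)%N.
  by move=> W; case/orP: (leq_total r s) => [/W//|/W W' /esym/W'].
move=> /eqP; rewrite eq_sym -subr_eq0 -natrB //.
by have [|/(padic_natr_neq0 p_pr) /negPf -> //] := posnP (s - r); lia.
Qed.

Lemma pball_ord_inj (N : int) (k : nat) (r s : 'I_(p ^ k)) :
  pball (p_pr := p_pr) (N + k) (p%:R ^ N * r%:R - p%:R ^ N * s%:R) -> r = s.
Proof.
rewrite -mulrBr pball_expM => -[z].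
rewrite -exprnP -!(rmorph_nat (@of_Zp p p_pr)) -rmorphXn -rmorphB -rmorphM.
move=> /of_Zp_inj rs; have : exists z : Zp, r%:R = s%:R + p%:R ^+ k * z.
  by exists z; rewrite -rs addrC subrK.
move=> /residue_eq_dvd; rewrite !residue_natr !modn_small //.
exact: ord_inj.
Qed.

Definition cball (x : V) (N : int) : set T :=
  [set y : V | forall i, pball N (y i 0 - x i 0)].

Lemma cball_center (x : V) N : cball x N x.
Proof. by move=> i; rewrite subrr; exact: pball0. Qed.

Lemma cball_sub (x y : V) (M N : int) : M <= N -> cball x M y ->
  cball y N `<=` cball x M.
Proof.
move=> MN xy z yz i; apply: pball_trans (xy i).
exact: pballW MN (yz i).
Qed.

Lemma cballC (x y : V) N : cball x N y -> cball y N x.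
Proof. by move=> xy i; exact: pballBC. Qed.

Lemma open_measurable_Qpn (A : set V) : open A -> measurable (A : set T).
Proof. exact: sub_sigma_algebra. Qed.

Lemma cball_open (x : V) N : open (cball x N : set V).
Proof.
apply/open_padic_colE => y xy; exists `|N|%N => z yz.
by apply: (cball_sub _ xy yz); lia.
Qed.

Lemma measurable_cball (x : V) N : measurable (cball x N).
Proof. by apply: open_measurable_Qpn; exact: cball_open. Qed.

Lemma cball_translate (a x : V) N :
  [set a + y | y in cball x N] = cball (a + x) N.
Proof.
apply/seteqP; split=> [_ [y xy <-] i|y axy].
  by rewrite !mxE opprD addrACA subrr add0r; exact: xy.
exists (y - a); last by rewrite addrC subrK.
by move=> i; have := axy i; rewrite !mxE opprD addrA.
Qed.

Lemma cball_exhaust (x : V) : exists k : nat, cball 0 (- k%:Z) x.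
Proof.
have /choice[k kx] : forall j, exists k : nat, pball (- k%:Z) (x j 0).
  by move=> j; exact: pball_ex.
exists (\max_j k j)%N => j; rewrite mxE subr0; apply: pballW (kx j).
by rewrite lerN2 lez_nat leq_bigmax.
Qed.

(** Representatives of [(p ^ N Z_p)^n] modulo [(p ^ (N + k) Z_p)^n]. *)
Definition digit_vec (N : int) (k : nat) (r : {ffun 'I_n -> 'I_(p ^ k)}) : V :=
  \col_i (p%:R ^ N * (r i)%:R).

Lemma cball_digits (N : int) (k : nat) :
  cball 0 N = \bigcup_(r : {ffun 'I_n -> 'I_(p ^ k)}) cball (digit_vec N r) (N + k).
Proof.
apply/seteqP; split=> [x x0|x [r _ rx]].
  have /choice[f fP] : forall i, exists r : 'I_(p ^ k),
      pball (N + k) (x i 0 - p%:R ^ N * r%:R).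
    by move=> i; apply: pball_approx; have := x0 i; rewrite mxE subr0.
  by exists [ffun i => f i] => // i; rewrite mxE ffunE.
apply: (cball_sub _ _ rx); first by rewrite lerDl.
move=> i; rewrite !mxE subr0 -[N in pball N _]addr0.
by apply: pballM; [exact: pball_exp|exact: pball_natr].
Qed.

Lemma trivIset_digits (N : int) (k : nat) :
  trivIset [set: {ffun 'I_n -> 'I_(p ^ k)}] (fun r => cball (digit_vec N r) (N + k)).
Proof.
move=> r s _ _ [x [rx sx]]; apply/ffunP => i.
apply: (@pball_ord_inj N); have := pball_trans (cballC rx i) (sx i).
by rewrite !mxE.
Qed.

Variable R : realType.
Implicit Types (mu nu : {measure set T -> \bar R}).

Definition translation_invariant mu : Prop :=
  forall (a : V) (A : set T), measurable A ->
    mu [set a + x | x in (A : set V)] = mu A.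

Lemma translation_invariant_cball mu (x : V) N : translation_invariant mu ->
  mu (cball x N) = mu (cball 0 N).
Proof.
move=> tmu; rewrite -(tmu x (cball 0 N)); last exact: measurable_cball.
by rewrite cball_translate addr0.
Qed.

(** This number is [p ^ (k * n)]; it is kept as a cardinality because what matters is that it is
    finite and the same for all measures. *)
Definition ndigits (k : nat) : nat := #|{: {ffun 'I_n -> 'I_(p ^ k)}}|.

Lemma cball_subdivide mu (N : int) (k : nat) : translation_invariant mu ->
  mu (cball 0 N) = ((ndigits k)%:R%:E * mu (cball 0 (N + k)))%E.
Proof.
move=> tmu; rewrite (cball_digits N k) measure_fin_bigcup //; first last.
- by move=> r _; exact: measurable_cball.
- exact: trivIset_digits.
- exact: finite_finset.
rewrite (eq_fsbigr (fun=> mu (cball 0 (N + k)))); last first.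
  by move=> r _; exact: translation_invariant_cball.
rewrite (_ : setT = [set` enum {: {ffun 'I_n -> 'I_(p ^ k)}}]); last first.
  by apply/seteqP; split=> r //= _; rewrite mem_enum.
by rewrite -fsbig_seq ?enum_uniq // big_enum /= sumr_const mule_natl.
Qed.

End Haar.

(** * Uniqueness of Haar measure, linear involutions and hyperplanes *)

Section HaarUniqueness.
Variables (p : nat) (p_pr : prime p) (R : realType).
Local Notation Zp := (padic_int p_pr).
Local Notation Qp := (padic p_pr).

Lemma continuous_measurable_Qpn m n (f : 'cV[Qp]_n -> 'cV[Qp]_m) :
  continuous f -> measurable_fun setT (f : Qpn p_pr n -> Qpn p_pr m).
Proof.
move=> /continuousP fc; apply: measurability; first by [].
move=> _ [B Bo <-]; rewrite setTI; apply: open_measurable_Qpn.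
exact: fc.
Qed.

Variable n : nat.
Local Notation V := 'cV[Qp]_n.
Local Notation T := (Qpn p_pr n).
Implicit Types (mu nu : {measure set T -> \bar R}).

Definition mulQpn (L : 'M[Qp]_n) : T -> T := fun x => L *m (x : V).

Lemma measurable_mulQpn (L : 'M[Qp]_n) : measurable_fun setT (mulQpn L).
Proof.
by apply: continuous_measurable_Qpn; exact: padic_mulmx_continuous.
Qed.


Definition cballs : set (set T) :=
  [set A | A = set0 \/ exists (x : V) N, A = cball x N].

(** Two balls with a common point [z] are both balls about [z], hence nested, and the smaller one is
    the intersection. *)
Lemma cballs_setI : setI_closed cballs.
Proof.
move=> A B [->|[x [M ->]]]; first by left; rewrite set0I.
move=> [->|[y [N ->]]]; first by left; rewrite setI0.
have [->|/set0P[z [xz yz]]] := eqVneq (cball x M `&` cball y N) set0.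
  by left.
right; exists z, (Num.max M N); apply/seteqP; split=> w.
  move=> [xw yw]; have [MN|NM] := leP M N.
    exact: cball_sub (lexx N) (cballC yz) _ yw.
  exact: cball_sub (lexx M) (cballC xz) _ xw.
move=> zw; split.
  by apply: cball_sub xz _ zw; rewrite le_max lexx.
by apply: cball_sub yz _ zw; rewrite le_max lexx orbT.
Qed.

(* Rational centres give countably many balls which form a base. *)
Lemma measurable_cballsE : @measurable _ T = <<s cballs >>.
Proof.
apply/seteqP; split; apply: smallest_sub; try exact: smallest_sigma_algebra.
  move=> A Ao; pose B (i : nat * {ffun 'I_n -> nat} * nat) : set T :=
    cball (\col_j (p%:R ^ (- i.1.1%:Z) * (i.1.2 j)%:R)) i.2.
  have -> : A = \bigcup_i (if `[< B i `<=` A >] then B i else set0).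
    apply/seteqP; split=> [x Ax|x [i _]]; last first.
      by case: asboolP => // BA; exact: BA.
    have [N NA] := (open_padic_colE A).1 Ao x Ax.
    have [K xK] := cball_exhaust x.
    (* [K + N] digits of a point of [p ^ (- K) Z_p] determine it modulo [p ^ N]; the ball about the
       rational centre is then the ball about [x]. *)
    have /choice[r rx] : forall j, exists r : 'I_(p ^ (K + N)),
        pball (- K%:Z + (K + N)%N%:Z) (x j 0 - p%:R ^ (- K%:Z) * r%:R).
      by move=> j; apply: pball_approx; have := xK j; rewrite mxE subr0.
    have Bx : B (K, [ffun j => r j : nat], N) x.
      move=> j; rewrite mxE /= ffunE; apply: pballW (rx j).
      by rewrite PoszD addKr.
    exists (K, [ffun j => r j : nat], N) => //.
    case: asboolP => // -[] y By; apply: NA.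
    exact: (cball_sub (lexx _) (cballC Bx) By).
  apply: (@countable_bigcupT_measurable _ (g_sigma_algebraType cballs)).
    exact: countableP.
  move=> i; case: asboolP => _ //; apply: sub_sigma_algebra.
  by right; eexists _, _.
by move=> _ [->|[x [N ->]]]; [exact: measurable0|exact: measurable_cball].
Qed.

Lemma normalized_haar_translation mu :
  normalized_haar mu -> translation_invariant mu.
Proof. by case. Qed.

Lemma normalized_haar_cball mu : normalized_haar mu -> mu (cball 0 0) = 1%E.
Proof.
move=> [_ <-]; congr (mu _); apply/seteqP; split=> x x0 i.
  by apply/pball0E; have := x0 i; rewrite mxE subr0.
by rewrite mxE subr0; apply/pball0E; exact: x0.
Qed.

Lemma normalized_haar_cball_finite mu (N : int) : normalized_haar mu ->
  (mu (cball 0 N) < +oo)%E.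
Proof.
move=> hmu; apply: (@le_lt_trans _ _ (mu (cball 0 (- `|N|%N%:Z)))).
  apply: le_measure; rewrite ?inE; [exact: measurable_cball..|].
  by apply: cball_sub; [lia|exact: cball_center].
rewrite (cball_subdivide _ `|N|%N (normalized_haar_translation hmu)) addNr.
by rewrite normalized_haar_cball // mule1 ltry.
Qed.

(** Subdivision expresses the measure of every ball through that of the unit ball, and balls form a
    generating family closed under intersection. *)
Lemma haar_unique mu nu (A : set T) : normalized_haar mu ->
  translation_invariant nu -> (nu (cball 0 0) < +oo)%E -> measurable A ->
  nu A = (nu (cball 0 0) * mu A)%E.
Proof.
move=> hmu tnu nu_fin mA; have tmu := normalized_haar_translation hmu.
have mu0 := normalized_haar_cball hmu.
have nu_fin_num : nu (cball 0 0) \is a fin_num.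
  by rewrite ge0_fin_numE.
have c_ge0 : 0 <= fine (nu (cball 0 0)) by exact: fine_ge0.
pose c : {nonneg R} := NngNum c_ge0.
have cE (B : set T) : (nu (cball 0 0) * mu B)%E = mscale c mu B.
  by rewrite /mscale /= fineK.
rewrite cE; apply: esym.
have ball_eq N : mscale c mu (cball 0 N) = nu (cball 0 N).
  rewrite -cE; case: N => k.
    have := cball_subdivide 0 k tmu; rewrite mu0 add0r => muk.
    rewrite (cball_subdivide 0 k tnu) add0r muleAC.
    by rewrite -muk mul1e.
  (* [Negz k] stands for [- (k + 1)], so [k.+1] more digits lead down to the unit ball. *)
  have muk := cball_subdivide (- k.+1%:Z) k.+1 tmu.
  have nuk := cball_subdivide (- k.+1%:Z) k.+1 tnu.
  rewrite addNr in muk nuk.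
  by rewrite NegzE muk nuk mu0 mule1 muleC.
apply: (measure_unique cballs (fun k => cball 0 (- k%:Z))) => //.
- exact: measurable_cballsE.
- exact: cballs_setI.
- by move=> k; right; exists 0, (- k%:Z).
- apply/seteqP; split=> // x _.
  by have [k xk] := cball_exhaust x; exists k.
- move=> _ [->|[x [N ->]]]; first by rewrite !measure0.
  rewrite (translation_invariant_cball _ _ tnu) -ball_eq /mscale /=.
  by congr (_ * _)%E; exact: translation_invariant_cball.
- move=> k; rewrite /mscale /= lte_mul_pinfty ?lee_fin //.
  exact: normalized_haar_cball_finite.
Qed.

(* The image measure is [c] times [mu] by uniqueness, and applying the involution
   twice gives [c ^ 2 = 1]. *)
Lemma haar_involution mu (L : 'M[Qp]_n) : normalized_haar mu ->
  L *m L = 1%:M -> measure_preserving mu (mulQpn L).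
Proof.
move=> hmu LL; have tmu := normalized_haar_translation hmu.
have mL := measurable_mulQpn L.
have mLpre (A : set T) : measurable A -> measurable (mulQpn L @^-1` A).
  by move=> mA; rewrite -[_ @^-1` _]setTI; exact: mL.
have LK (x : V) : L *m (L *m x) = x by rewrite mulmxA LL mul1mx.
have [nu nuE] : exists nu : {measure set T -> \bar R},
    forall A, nu A = mu (mulQpn L @^-1` A).
  by unshelve (exists (pushforward mu (mulQpn L))).
have tnu : translation_invariant nu.
  move=> a A mA; rewrite !nuE -(tmu (L *m a) _ (mLpre _ mA)).
  congr (mu _); rewrite /preimage /mulQpn; apply/seteqP; split=> x /=.
    move=> [y Ay ayx]; exists (L *m y); first by rewrite /= LK.
    by rewrite -mulmxDr ayx LK.
  by move=> [y Ay <-]; exists (L *m y) => //; rewrite mulmxDr LK.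
have nu_fin : (nu (cball 0 0) < +oo)%E.
  (* The entries of [L] lie in [p ^ (- K) Z_p]; since [x = L *m (L *m x)], the preimage of the unit
     ball lies in the ball of index [- K]. *)
  have /choice[f fP] : forall ij : 'I_n * 'I_n, exists k : nat,
      pball (- k%:Z) (L ij.1 ij.2).
    by move=> ij; exact: pball_ex.
  pose K := (\max_ij f ij)%N.
  rewrite nuE; apply: le_lt_trans (normalized_haar_cball_finite (- K%:Z) hmu).
  apply: le_measure; rewrite ?inE.
  - by apply: mLpre; exact: measurable_cball.
  - exact: measurable_cball.
  move=> x Lx i; rewrite mxE subr0 -(LK x) mxE; apply: pball_sum => j _.
  rewrite -[- _]addr0; apply: pballM.
    by apply: pballW (fP (i, j)); rewrite lerN2 lez_nat (leq_bigmax (i, j)).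
  by have := Lx j; rewrite [X in _ - X]mxE subr0.
have nuL := haar_unique hmu tnu nu_fin.
have c1 : nu (cball 0 0) = 1%E.
  have := nuL _ (mLpre _ (measurable_cball 0 0)); rewrite -nuE.
  rewrite nuE -comp_preimage (_ : _ \o _ = id); last first.
    by apply/funext => x /=; exact: LK.
  rewrite preimage_id (normalized_haar_cball hmu).
  have : (0 <= nu (cball 0 0))%E by [].
  case: (nu (cball 0 0)) nu_fin => [r| |] //= _; rewrite lee_fin => r_ge0 [].
  move/esym/eqP; rewrite -expr2 sqrf_eq1 => /orP[/eqP ->//|/eqP r1].
  by move: r_ge0; rewrite r1 lerNr oppr0 ler10.
by split=> // A mA; rewrite -nuE nuL // c1 mul1e.
Qed.

Definition subQpn (a : V) : T -> T := fun x => (x : V) - a.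

Lemma measurable_subQpn (a : V) : measurable_fun setT (subQpn a).
Proof.
apply: continuous_measurable_Qpn => x A /nbhs_padic_colE[N NA].
apply/nbhs_padic_colE; exists N => y yx; apply: NA => i.
by rewrite !mxE opprB addrA subrK; exact: yx.
Qed.

Lemma measurable_hyperplane (j : 'I_n) :
  measurable ([set x : V | x j 0 = 0] : set T).
Proof.
rewrite -[X in measurable X]setCK; apply: measurableC; apply: open_measurable_Qpn.
apply/open_padic_colE => x /eqP xj.
have [k xk] := padic_not_pball xj; exists k => y yx /= yj; apply: xk.
by rewrite -[x j 0]subr0 -yj; exact: pballBC.
Qed.

(* Infinitely many disjoint translates of a bounded piece of the hyperplane fit in
   a ball of finite measure. *)
Lemma haar_hyperplane mu (j : 'I_n) : normalized_haar mu ->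
  mu [set x : V | x j 0 = 0] = 0%E.
Proof.
move=> hmu; have tmu := normalized_haar_translation hmu.
have mH := measurable_hyperplane j.
set H : set T := [set x : V | x j 0 = 0] in mH *.
pose HB (k : nat) : set T := H `&` cball 0 (- k%:Z).
have mHB k : measurable (HB k) by apply: measurableI => //; exact: measurable_cball.
have -> : H = \bigcup_k HB k.
  apply/seteqP; split=> [x Hx|x [k _ []] //].
  by have [k xk] := cball_exhaust x; exists k.
apply/negligibleP; first exact: bigcupT_measurable.
apply: negligible_bigcup => k; apply/negligibleP => //.
(* Shifts by natural numbers in direction [j] are pairwise distinct, yet p-adically integral, so the
   translates stay in the ball of index [- k]. *)
pose e (r : nat) : V := \col_i (if i == j then r%:R else 0).
pose F (r : nat) : set T := [set e r + x | x in (HB k : set V)].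
have FHB r : mu (F r) = mu (HB k) by exact: tmu.
have mF r : measurable (F r).
  rewrite [F r](_ : _ = subQpn (e r) @^-1` HB k).
    by rewrite -[_ @^-1` _]setTI; exact: measurable_subQpn.
  apply/seteqP; split=> [_ [x HBx <-]|x HBx].
    by rewrite /preimage /= /subQpn addrAC subrr add0r.
  by exists (x - e r) => //; rewrite addrC subrK.
have Fsub K : (K%:R%:E * mu (HB k) <= mu (cball 0 (- k%:Z)))%E.
  have <- : mu (\big[setU/set0]_(r < K) F r) = (K%:R%:E * mu (HB k))%E.
    rewrite measure_bigsetU_ord //.
      rewrite (eq_bigr (fun=> mu (HB k))); last by move=> r _; exact: FHB.
      rewrite -(big_mkord xpredT (fun=> mu (HB k))) sumr_const_nat subn0.
      exact/esym/mule_natl.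
    move=> r s _ _ [_ [[x [Hx _] <-] [y [Hy _] exy]]].
    have := congr1 (fun z : V => z j 0) exy; rewrite !mxE eqxx Hx Hy !addr0.
    by move=> /padic_natr_inj/esym; exact: ord_inj.
  apply: le_measure; rewrite ?inE.
  - exact: bigsetU_measurable.
  - exact: measurable_cball.
  rewrite -bigcup_mkord => x [r _ [y [_ yk] <-]] i.
  rewrite !mxE subr0; apply: pballD; last by have := yk i; rewrite mxE subr0.
  by case: ifP => _; [apply: pballW (pball_natr _ _); lia|exact: pball0].
move: Fsub (normalized_haar_cball_finite (- k%:Z) hmu).
have : (0 <= mu (HB k))%E by [].
have : (0 <= mu (cball 0 (- k%:Z)))%E by [].
move: (mu (cball 0 (- k%:Z))) => [c| |] //= _.
case: (mu (HB k)) => [a| |] // a_ge0 Fsub _; last first.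
  by have := Fsub 1%N; rewrite mul1e.
move: a_ge0; rewrite lee_fin le_eqVlt => /predU1P[<-//|a_gt0].
have := Fsub (Num.truncn (c / a)).+1; rewrite -EFinM lee_fin -ler_pdivlMr //.
by rewrite leNgt truncnS_gt.
Qed.

End HaarUniqueness.

(** * Reflections of diagonal forms *)

Section DiagonalForm.
Variable F : fieldType.

(** The dimension is general because reflections are needed both for the Lorentz form and for its
    restriction to the three coordinates of a chart. *)
Definition diag_form n (s : 'I_n -> F) (x y : 'cV[F]_n) : F :=
  \sum_i s i * (x i 0 * y i 0).

Definition diag_covec n (s : 'I_n -> F) (v : 'cV[F]_n) : 'rV[F]_n :=
  \row_i (s i * v i 0).

Definition diag_refl n (s : 'I_n -> F) (v : 'cV[F]_n) : 'M[F]_n :=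
  1%:M - (2 / diag_form s v v) *: (v *m diag_covec s v).

(** In dimension 4 this is convertible to [insert_coord], so that its lemmas apply to the charts. *)
Definition col_insert n (l : 'I_n.+1) (t : F) (u : 'cV[F]_n) : 'cV[F]_n.+1 :=
  \col_i (if unlift l i is Some j then u j 0 else t).

Definition col_remove n (l : 'I_n.+1) (x : 'cV[F]_n.+1) : 'cV[F]_n :=
  \col_j x (lift l j) 0.

Section Theory.
Variables (n : nat) (s : 'I_n -> F).
Implicit Types (v x y : 'cV[F]_n).

Lemma diag_formC x y : diag_form s x y = diag_form s y x.
Proof. by apply: eq_bigr => i _; rewrite (mulrC (x i 0)). Qed.

Lemma diag_formDl x y v : diag_form s (x + y) v = diag_form s x v + diag_form s y v.
Proof. by rewrite -big_split; apply: eq_bigr => i _; rewrite mxE /=; ring. Qed.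

Lemma diag_formZl a x v : diag_form s (a *: x) v = a * diag_form s x v.
Proof.
by rewrite /diag_form mulr_sumr; apply: eq_bigr => i _; rewrite mxE; ring.
Qed.

Lemma diag_formBl x y v : diag_form s (x - y) v = diag_form s x v - diag_form s y v.
Proof. by rewrite -scaleN1r diag_formDl diag_formZl mulN1r. Qed.

Lemma diag_covecE v x : diag_covec s v *m x = (diag_form s v x)%:M.
Proof.
apply/matrixP => i j; rewrite !ord1 !mxE eqxx mulr1n; apply: eq_bigr => k _.
by rewrite mxE mulrA.
Qed.

Lemma diag_reflE v x :
  diag_refl s v *m x = x - (2 / diag_form s v v * diag_form s v x) *: v.
Proof.
rewrite mulmxBl mul1mx -scalemxAl -mulmxA diag_covecE mul_mx_scalar.
by rewrite scalerA.
Qed.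

Lemma diag_refl_form v x y : diag_form s v v != 0 ->
  diag_form s (diag_refl s v *m x) (diag_refl s v *m y) = diag_form s x y.
Proof.
move=> v0; rewrite !diag_reflE.
set a := 2 / _ * diag_form s v x; set b := 2 / _ * diag_form s v y.
rewrite diag_formBl diag_formZl (diag_formC x (y - _)) (diag_formC v (y - _)).
rewrite !diag_formBl !diag_formZl (diag_formC y x) (diag_formC y v) /a /b.
by field.
Qed.

Lemma diag_refl_involutive v : diag_form s v v != 0 ->
  diag_refl s v *m diag_refl s v = 1%:M.
Proof.
move=> v0; have PP : (v *m diag_covec s v) *m (v *m diag_covec s v) =
    diag_form s v v *: (v *m diag_covec s v).
  by rewrite -mulmxA (mulmxA (diag_covec s v)) diag_covecE mul_scalar_mx scalemxAr.
rewrite {1}/diag_refl mulmxBl mul1mx -scalemxAl mulmxBr mulmx1 -scalemxAr PP.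
rewrite scalerA divfK // scaler_nat mulr2n opprD addNKr scalerN opprK.
by rewrite /diag_refl subrK.
Qed.

(** For vectors of equal norm the norm of [x - y] is twice its pairing with [x], so the reflection
    subtracts exactly [x - y] from [x]. *)
Lemma diag_refl_swap x y : diag_form s x x = diag_form s y y ->
  diag_form s (x - y) (x - y) != 0 -> diag_refl s (x - y) *m x = y.
Proof.
move=> xy xy0; rewrite diag_reflE.
have e : diag_form s (x - y) (x - y) = 2 * diag_form s (x - y) x.
  rewrite diag_formBl !(diag_formC _ (x - y)) !diag_formBl xy (diag_formC y x).
  by ring.
rewrite -mulrA (mulrC _^-1) mulrA -e divff // scale1r.
by rewrite opprB addrC subrK.
Qed.

(** Parallelogram law. It provides the fallback when [x - y] is isotropic: reflect [x] to [- y]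
    instead. *)
Lemma diag_form_opposite x y : diag_form s x x = diag_form s y y ->
  diag_form s (x - y) (x - y) = 0 ->
  diag_form s (x - - y) (x - - y) = 2 * 2 * diag_form s y y.
Proof.
rewrite opprK !diag_formBl !diag_formDl.
rewrite !(diag_formC _ (x - y)) !(diag_formC _ (x + y)).
rewrite !diag_formBl !diag_formDl (diag_formC y x) => -> e.
by rewrite -[LHS](addr0 _) -[X in _ + X]e; ring.
Qed.

Lemma diag_refl_self v : diag_form s v v != 0 -> diag_refl s v *m v = - v.
Proof.
move=> v0; rewrite diag_reflE divfK // scaler_nat mulr2n.
by rewrite opprD addrA subrr add0r.
Qed.

End Theory.

Lemma col_insert_lift n (l : 'I_n.+1) t (u : 'cV[F]_n) j :
  col_insert l t u (lift l j) 0 = u j 0.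
Proof. by rewrite mxE liftK. Qed.

Lemma col_insert_same n (l : 'I_n.+1) t (u : 'cV[F]_n) : col_insert l t u l 0 = t.
Proof. by rewrite mxE unlift_none. Qed.

Lemma col_insert_remove n (l : 'I_n.+1) (x : 'cV[F]_n.+1) :
  col_insert l (x l 0) (col_remove l x) = x.
Proof.
apply/matrixP => i j; rewrite ord1 mxE; case: unliftP => [k ->|-> //].
by rewrite mxE.
Qed.

Lemma diag_form_insert n (s : 'I_n.+1 -> F) l t u a b :
  diag_form s (col_insert l t u) (col_insert l a b) =
  s l * (t * a) + diag_form (s \o lift l) u b.
Proof.
rewrite /diag_form (bigD1_ord l) //= !col_insert_same; congr (_ + _).
by apply: eq_bigr => j _; rewrite !col_insert_lift.
Qed.

(** As the [l]-th coordinate of the reflecting vector is 0, its norm and its pairings involve only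
    the other coordinates. *)
Lemma diag_refl_insert n (s : 'I_n.+1 -> F) l t u v :
  diag_refl s (col_insert l 0 v) *m col_insert l t u =
  col_insert l t (diag_refl (s \o lift l) v *m u).
Proof.
rewrite !diag_reflE !diag_form_insert !mul0r !mulr0 !add0r.
apply/matrixP => i j; rewrite ord1 !mxE.
by case: unlift => [k|]; rewrite ?mxE ?mulr0 ?subr0.
Qed.

(** Taylor coefficients at [u0] of [a * (c - diag_form s u u)], divided by its value at [u0]. The
    index [(j, false)] is the linear term in coordinate [j], and [(j, true)] the quadratic one. *)
Definition quad_coef n (s : 'I_n -> F) (a c : F) (u0 : 'cV[F]_n)
    (i : 'I_n * bool) : F :=
  - (a * s i.1 * (if i.2 then 1 else 2 * u0 i.1 0)) / (a * (c - diag_form s u0 u0)).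

Definition quad_exp n (i : 'I_n * bool) : {ffun 'I_n -> nat} :=
  [ffun j => if j == i.1 then i.2.+1 else 0%N].

Lemma mon_quad_exp n (i : 'I_n * bool) (h : 'cV[F]_n) :
  mon (quad_exp i) h = h i.1 0 ^+ i.2.+1.
Proof.
rewrite /mon (bigD1 i.1) //= ffunE eqxx big1 ?mulr1 // => j ji.
by rewrite ffunE (negPf ji) expr0.
Qed.

Lemma quad_expand n (s : 'I_n -> F) (a c : F) (u u0 : 'cV[F]_n) :
  a * (c - diag_form s u0 u0) != 0 ->
  a * (c - diag_form s u u) = a * (c - diag_form s u0 u0) *
    (1 + \sum_i quad_coef s a c u0 i * mon (quad_exp i) (u - u0)).
Proof.
set D := a * (c - diag_form s u0 u0) => D0.
rewrite -(pair_bigA _ (fun j b => quad_coef s a c u0 (j, b) *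
  mon (quad_exp (j, b)) (u - u0))) /=.
rewrite [RHS]mulrDr mulr1 mulr_sumr.
have -> : \sum_i D * \sum_b quad_coef s a c u0 (i, b) *
    mon (quad_exp (i, b)) (u - u0) =
    \sum_i - (a * (s i * (u i 0 * u i 0) - s i * (u0 i 0 * u0 i 0))).
  apply: eq_bigr => i _; rewrite big_bool !mon_quad_exp /quad_coef /= -/D.
  rewrite !mxE expr1; move: (u i 0) (u0 i 0) => x y; field.
  exact: D0.
by rewrite sumrN -mulr_sumr sumrB /D /diag_form; ring.
Qed.

End DiagonalForm.

(** * Charts of the hyperboloid *)

Section LorentzCharts.
Variables (p : nat) (p_pr : prime p) (p_odd : p <> 2%N).
Local Notation Zp := (padic_int p_pr).
Local Notation Qp := (padic p_pr).

Definition lorentz_sign (i : 'I_4) : Qp := if i == 0 then 1 else -1.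
Local Notation sg := lorentz_sign.

Lemma lorentz_formE (x y : 'cV[Qp]_4) : lorentz_form x y = diag_form sg x y.
Proof.
have e1 : lift ord0 ord0 = 1 :> 'I_4 by exact: val_inj.
have e2 : lift ord0 (lift ord0 ord0) = 2 :> 'I_4 by exact: val_inj.
have e3 : lift ord0 (lift ord0 (lift ord0 ord0)) = 3 :> 'I_4 by exact: val_inj.
rewrite /diag_form !big_ord_recl big_ord0 e3 e2 e1 /lorentz_sign /=.
by rewrite !mulN1r mul1r addr0 !addrA.
Qed.

Lemma lorentz_sign_sqr i : sg i * sg i = 1.
Proof. by rewrite /lorentz_sign; case: ifP => _; rewrite ?mulrNN mulr1. Qed.

Lemma lorentz_sign_neq0 i : sg i != 0.
Proof.
apply/eqP => s0; have := lorentz_sign_sqr i; rewrite s0 mul0r => /eqP.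
by rewrite eq_sym oner_eq0.
Qed.

Variable m : Qp.
Hypothesis m0 : m <> 0.

Definition fiber_sqr (l : 'I_4) (u : 'cV[Qp]_3) : Qp :=
  sg l * (m ^+ 2 - diag_form (sg \o lift l) u u).

Lemma hyperboloid_insert l t u :
  hyperboloid m (col_insert l t u) <-> t ^+ 2 = fiber_sqr l u.
Proof.
rewrite /hyperboloid /= /lorentz_Q lorentz_formE diag_form_insert /fiber_sqr.
rewrite -expr2; split=> [<-|->].
  by rewrite addrK mulrA lorentz_sign_sqr mul1r.
by rewrite mulrA lorentz_sign_sqr mul1r subrK.
Qed.

(** A nonzero square has exactly one root in [padic_half], so this is where [fiber_sqr] is a nonzero
    square. *)
Definition chart_dom (l : 'I_4) : set 'cV[Qp]_3 :=
  [set u | exists2 a, padic_half a & a ^+ 2 = fiber_sqr l u].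

(* [c = 1] and [c = -1] select the two sheets over the same domain. *)
Definition chart_coord (l : 'I_4) (c : Qp) (u : 'cV[Qp]_3) : Qp :=
  xget 0 [set a | padic_half (c * a) /\ a ^+ 2 = fiber_sqr l u].

Definition chart_map (l : 'I_4) (c : Qp) (u : 'cV[Qp]_3) : 'cV[Qp]_4 :=
  insert_coord l (chart_coord l c u) u.

Definition chart_piece (l : 'I_4) (c : Qp) : set (Qpn p_pr 4) :=
  [set x | hyperboloid m x /\ padic_half (c * (x : 'cV[Qp]_4) l 0)].

Lemma chart_coordP l c u : c ^+ 2 = 1 -> chart_dom l u ->
  padic_half (c * chart_coord l c u) /\ chart_coord l c u ^+ 2 = fiber_sqr l u.
Proof.
move=> c1 [a ha a2]; rewrite /chart_coord.
apply: (@xgetPex _ 0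
  [set b | padic_half (c * b) /\ b ^+ 2 = fiber_sqr l u]).
by exists (c * a); rewrite /= mulrA -expr2 c1 mul1r exprMn c1 mul1r.
Qed.

Lemma chart_coord_unique l c u a : c ^+ 2 = 1 -> padic_half (c * a) ->
  a ^+ 2 = fiber_sqr l u -> chart_dom l u /\ chart_coord l c u = a.
Proof.
move=> c1 ha a2; have du : chart_dom l u.
  by exists (c * a) => //; rewrite exprMn c1 mul1r.
split=> //; have [hb b2] := chart_coordP c1 du.
have c0 : c != 0 by rewrite -sqrf_eq0 c1 oner_eq0.
apply: (mulfI c0); apply: (padic_half_sqr_inj p_odd hb ha).
by rewrite [LHS]exprMn [RHS]exprMn b2 a2.
Qed.

Lemma padic_half_neq0 (a : Qp) : padic_half a -> a != 0.
Proof.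
move=> ha; apply/eqP => a0; apply: (padic_half_disjoint p_odd ha).
by rewrite a0 oppr0 -a0.
Qed.

Lemma near_chart l u0 :
  \forall u \near u0, pball 1 (\sum_i quad_coef (sg \o lift l) (sg l) (m ^+ 2) u0 i *
    mon (quad_exp i) (u - u0)).
Proof.
set k := quad_coef _ _ _ _.
have small : \forall u \near u0, forall i, pball 1 (k i * mon (quad_exp i) (u - u0)).
  apply: (filter_forall _ (fun i => near_mon_small (k i) u0 _)) => i.
  by exists i.1; rewrite ffunE eqxx.
by apply: filterS small => u ku; exact: pball_sum.
Qed.

Lemma fiber_sqr_neq0 l u : chart_dom l u -> fiber_sqr l u != 0.
Proof. by move=> [a /padic_half_neq0 a0 <-]; rewrite expf_neq0. Qed.

(** Near [u0] the relative change of [fiber_sqr] lies in [p Z_p], and [1 + t] is a square for such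
    [t]. *)
Lemma chart_dom_near l u0 : chart_dom l u0 -> \forall u \near u0, chart_dom l u.
Proof.
move=> du0; have G0 := fiber_sqr_neq0 du0; have [a ha a2] := du0.
apply: filterS (near_chart l u0) => u /(padic_half_sqrt p_odd ha)[b hb b2].
by exists b => //; rewrite b2 a2 -quad_expand.
Qed.

Lemma chart_dom_open l : open (chart_dom l).
Proof. by rewrite openE => u /chart_dom_near. Qed.

Lemma chart_coord_analytic l c u0 : c ^+ 2 = 1 -> chart_dom l u0 ->
  analytic_at (chart_coord l c) u0.
Proof.
move=> c1 du0; have G0 := fiber_sqr_neq0 du0.
have c0 : c != 0 by rewrite -sqrf_eq0 c1 oner_eq0.
apply: (analytic_at_sqrt p_odd (k := quad_coef (sg \o lift l) (sg l) (m ^+ 2) u0)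
  (e := @quad_exp 3) c0).
  by move=> i; exists i.1; rewrite ffunE eqxx.
apply: filterS (chart_dom_near du0) => u du.
have [hu u2] := chart_coordP c1 du; have [_ u02] := chart_coordP c1 du0.
by split=> //; rewrite u2 u02 -quad_expand.
Qed.

Lemma chart_pieceE l c : c ^+ 2 = 1 ->
  chart_piece l c =
  chart_map l c @` chart_dom l.
Proof.
move=> c1; apply/seteqP; split=> [x [Vx hx]|_ [u du <-]].
  rewrite -(col_insert_remove l x) in Vx *.
  move: Vx => /hyperboloid_insert x2.
  have [du e] := chart_coord_unique c1 hx x2.
  by exists (col_remove l x) => //; rewrite /chart_map e.
have [hu u2] := chart_coordP c1 du; split; first by apply/hyperboloid_insert.
by rewrite /chart_map [insert_coord _ _ _ _ _]col_insert_same.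
Qed.

Lemma chart_dQ_neq0 l c u : c ^+ 2 = 1 -> chart_dom l u ->
  lorentz_dQ l (chart_map l c u) != 0.
Proof.
move=> c1 du; have [/padic_half_neq0] := chart_coordP c1 du.
rewrite mulf_eq0 negb_or => /andP[_ u0] _.
have two0 : (2 : Qp) != 0 by exact: padic_natr_neq0.
rewrite /lorentz_dQ /chart_map [insert_coord _ _ _ _ _]col_insert_same.
by apply: mulf_neq0 u0; case: ifP => _; rewrite ?oppr_eq0.
Qed.

Lemma lorentz_Q_continuous : continuous (@lorentz_Q p p_pr).
Proof.
rewrite (_ : @lorentz_Q p p_pr = fun x => diag_form sg x x); last first.
  by apply/funext => x; exact: lorentz_formE.
apply: padic_continuous_sum => i; apply: padic_continuousM.
  exact: cst_continuous.
by apply: padic_continuousM; exact: padic_continuous_coord.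
Qed.

Lemma measurable_hyperboloid : measurable (hyperboloid m : set (Qpn p_pr 4)).
Proof.
rewrite -[X in measurable X]setCK; apply: measurableC; apply: open_measurable_Qpn.
rewrite openE => x /= Qx; have /padic_not_pball[k xk] : lorentz_Q x - m ^+ 2 != 0.
  by rewrite subr_eq0; apply/eqP.
apply: filterS (padic_near_pball k x lorentz_Q_continuous) => y yx Qy.
by apply: xk; rewrite -Qy; exact: pballBC.
Qed.

Lemma measurable_chart_piece l c : measurable (chart_piece l c).
Proof.
apply: measurableI; first exact: measurable_hyperboloid.
apply: open_measurable_Qpn; rewrite openE => x hx.
have [k xk] := padic_half_open p_odd hx.
have cc : continuous (fun x : 'cV[Qp]_4 => c * x l 0).
  by apply: padic_continuousM; [exact: cst_continuous|exact: padic_continuous_coord].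
by apply: filterS (padic_near_pball k x cc) => y; exact: xk.
Qed.

Lemma chart_piece_disjoint l : chart_piece l 1 `&` chart_piece l (-1) = set0.
Proof.
apply/seteqP; split=> x //= [[_]]; rewrite mul1r => hx [_].
by rewrite mulN1r; exact: padic_half_disjoint.
Qed.

Lemma chart_piece_cover (x : 'cV[Qp]_4) l : hyperboloid m x -> x l 0 != 0 ->
  chart_piece l 1 x \/ chart_piece l (-1) x.
Proof.
move=> Vx /(padic_half_cover p_odd)[h|h]; [left|right].
  by split; rewrite ?mul1r.
by split; rewrite ?mulN1r.
Qed.

Lemma padic_abs_ge0 (R : realType) (x : Qp) : 0 <= padic_abs R x.
Proof. by rewrite /padic_abs; case: ifP => // _; exact: exprz_ge0. Qed.

Variables (R : realType) (mu : {measure set (Qpn p_pr 3) -> \bar R}).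
Variable lam : {measure set (Qpn p_pr 4) -> \bar R}.
Hypotheses (hmu : normalized_haar mu) (hlam : gelfand_leray mu m lam).

Lemma chart_measure l c (A : set (Qpn p_pr 4)) : c ^+ 2 = 1 ->
  measurable A -> A `<=` chart_piece l c ->
  lam A = (\int[mu]_(u in chart_dom l `&` chart_map l c @^-1` A)
             ((padic_abs R (lorentz_dQ l (chart_map l c u)))^-1)%:E)%E.
Proof.
move=> c1 mA; rewrite chart_pieceE // => Ap; apply: (proj2 hlam) => //.
- exact: chart_dom_open.
- by move=> u du; exact: chart_coord_analytic.
- by move=> u du; apply/hyperboloid_insert; have [] := chart_coordP c1 du.
- by move=> u du; exact: chart_dQ_neq0.
Qed.

(** For [l != l'] the coordinate [l] is one of the parameters of the chart, so the set is cut out by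
    a Haar-null hyperplane; for [l = l'] it is empty. *)
Lemma coord_hyperplane_piece_null l l' c : c ^+ 2 = 1 ->
  lam ([set x : 'cV[Qp]_4 | x l 0 = 0] `&` chart_piece l' c) = 0%E.
Proof.
move=> c1; set A : set (Qpn p_pr 4) := _ `&` _.
have mA : measurable A.
  apply: measurableI; first exact: measurable_hyperplane.
  exact: measurable_chart_piece.
case: (unliftP l' l) => [j lj|ll]; last first.
  rewrite (_ : A = set0) ?measure0 //; apply/seteqP; split=> x //= [/= xl [_]].
  by rewrite -ll xl mulr0 => /padic_half_neq0; rewrite eqxx.
rewrite (chart_measure (l := l') c1 mA); last by move=> x [].
apply: integral_null_set (measurable_hyperplane j) (haar_hyperplane j hmu) _ _
  => [u [du [/= ul _]]|u _].
  by move: ul; rewrite lj /chart_map [insert_coord _ _ _ _ _]col_insert_lift.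
by rewrite lee_fin invr_ge0 padic_abs_ge0.
Qed.

Lemma coord_hyperplane_null l :
  lam ([set x : 'cV[Qp]_4 | x l 0 = 0] `&` hyperboloid m) = 0%E.
Proof.
(* The eight sheets as a sequence: [i./2] is the coordinate, the parity of [i] the sign. From 8 on,
   [inord] falls back to index 0 and only repeats sheets. *)
pose B (i : nat) : set (Qpn p_pr 4) :=
  [set x : 'cV[Qp]_4 | x l 0 = 0] `&` chart_piece (inord i./2) ((-1) ^+ odd i).
have mB i : measurable (B i).
  apply: measurableI; first exact: measurable_hyperplane.
  exact: measurable_chart_piece.
have -> : [set x : 'cV[Qp]_4 | x l 0 = 0] `&` hyperboloid m = \bigcup_i B i.
  apply/seteqP; split=> [x [xl Vx]|x [i _ [xl [Vx _]]] //].
  have [l' xl'] : exists l', x l' 0 != 0.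
    apply: contra_notP m0 => x0; apply/eqP; rewrite -sqrf_eq0.
    have <- : lorentz_Q x = m ^+ 2 := Vx.
    rewrite /lorentz_Q lorentz_formE /diag_form big1 // => i _.
    suff -> : x i 0 = 0 by rewrite mulr0 mulr0.
    by apply/eqP; apply: contraT => xi; case: x0; exists i.
  have inl : inord l' = l' by exact: inord_val.
  have [pl|pl] := chart_piece_cover Vx xl'.
    by exists l'.*2 => //; split=> //; rewrite doubleK odd_double inl.
  exists l'.*2.+1 => //; split=> //=.
  by rewrite uphalf_double odd_double inl.
apply/negligibleP; first exact: bigcupT_measurable.
apply: negligible_bigcup => i; apply/negligibleP => //.
by apply: coord_hyperplane_piece_null; rewrite sqrr_sign.
Qed.

Lemma lam_split l (A : set (Qpn p_pr 4)) : measurable A ->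
  lam A = (lam (A `&` chart_piece l 1%R) + lam (A `&` chart_piece l (-1)%R))%E.
Proof.
move=> mA; have mP c : measurable (A `&` chart_piece l c).
  by apply: measurableI => //; exact: measurable_chart_piece.
pose Z : set (Qpn p_pr 4) := [set x : 'cV[Qp]_4 | x l 0 = 0] `&` hyperboloid m.
have mV := measurable_hyperboloid.
have mZ : measurable Z by apply: measurableI => //; exact: measurable_hyperplane.
pose N : set (Qpn p_pr 4) := ~` hyperboloid m `|` Z.
have mN : measurable N by apply: measurableU => //; exact: measurableC.
have N0 : lam N = 0%E.
  rewrite measureU0 //; first exact: (proj1 hlam).
  - exact: measurableC.
  - exact: coord_hyperplane_null.
have AE : A = (A `&` chart_piece l 1 `|` A `&` chart_piece l (-1)) `|` (A `&` N).
  apply/seteqP; split=> [x Ax|x [[[]|[]]|[]] //].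
  have [Vx|Vx] := pselect (hyperboloid m x); last by right; split=> //; left.
  have [x0|x0] := eqVneq ((x : 'cV[Qp]_4) l 0) 0; first by right; split=> //; right.
  by left; have [xP|xP] := chart_piece_cover Vx x0; [left|right].
rewrite [in LHS]AE measureU0.
- rewrite measureU // setIACA setIid chart_piece_disjoint.
  exact: setI0.
- exact: measurableU.
- exact: measurableI.
- exact: subset_measure0 (measurableI _ _ mA mN) mN (@subIsetr _ _ _) N0.
Qed.

Lemma refl_measure_preserving l (v : 'cV[Qp]_3) :
  diag_form (sg \o lift l) v v != 0 ->
  measure_preserving lam (mulQpn (diag_refl sg (col_insert l 0 v))).
Proof.
move=> v0; set L := diag_refl _ _; set g := diag_refl (sg \o lift l) v.
have v0' : diag_form sg (col_insert l 0 v) (col_insert l 0 v) != 0.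
  by rewrite diag_form_insert mulr0 mulr0 add0r.
have gP : measure_preserving mu (mulQpn g).
  by apply: haar_involution hmu _; exact: diag_refl_involutive.
have gK : cancel (mulQpn g) (mulQpn g).
  by move=> u; rewrite /mulQpn mulmxA diag_refl_involutive // mul1mx.
split; first exact: measurable_mulQpn.
have Lpre (A : set (Qpn p_pr 4)) : measurable A -> measurable (mulQpn L @^-1` A).
  by move=> mA; rewrite -[_ @^-1` _]setTI; exact: measurable_mulQpn.
have Lins t u : L *m col_insert l t u = col_insert l t (g *m u).
  exact: diag_refl_insert.
have fiber_g u : fiber_sqr l (g *m u) = fiber_sqr l u.
  by rewrite /fiber_sqr diag_refl_form.
have dom_g u : chart_dom l (g *m u) <-> chart_dom l u.
  by rewrite /chart_dom /= fiber_g.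
have coord_g c u : chart_coord l c (g *m u) = chart_coord l c u.
  by rewrite /chart_coord fiber_g.
have Lpiece c : mulQpn L @^-1` chart_piece l c = chart_piece l c.
  apply/seteqP; split=> x; rewrite -(col_insert_remove l x);
    rewrite /chart_piece /preimage /= /mulQpn Lins !col_insert_same;
    by rewrite !hyperboloid_insert fiber_g.
have Lpiece_lam c (A : set (Qpn p_pr 4)) : c ^+ 2 = 1 -> measurable A ->
    A `<=` chart_piece l c -> lam (mulQpn L @^-1` A) = lam A.
  move=> c1 mA Ac; rewrite (chart_measure c1 mA Ac).
  rewrite (chart_measure (l := l) c1 (Lpre _ mA)); last first.
    by rewrite -Lpiece => x; exact: Ac.
  have chart_g u : chart_map l c (g *m u) = L *m chart_map l c u.
    by rewrite /chart_map coord_g; exact: esym (Lins _ _).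
  rewrite -[RHS](integral_measure_preserving _ _ gK gK (measurable_mulQpn g) gP).
  have -> : mulQpn g @^-1` (chart_dom l `&` chart_map l c @^-1` A) =
      chart_dom l `&` chart_map l c @^-1` (mulQpn L @^-1` A).
    apply/seteqP; split=> u [/dom_g du]; rewrite /preimage /= /mulQpn.
      by rewrite chart_g.
    by rewrite -chart_g.
  apply: eq_integral => u _; rewrite /lorentz_dQ /mulQpn /chart_map.
  by rewrite ![insert_coord _ _ _ _ _]col_insert_same coord_g.
move=> A mA; rewrite (lam_split l (Lpre _ mA)) (lam_split l mA).
have key c : c ^+ 2 = 1 -> lam (mulQpn L @^-1` A `&` chart_piece l c) =
    lam (A `&` chart_piece l c).
  move=> c1; rewrite -[in LHS](Lpiece c) -preimage_setI (Lpiece_lam c) //.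
  by apply: measurableI => //; exact: measurable_chart_piece.
by rewrite !key ?sqrrN ?expr1n.
Qed.

End LorentzCharts.

(** * Generation by reflections *)

(* If the candidate [(a, b)] with [a + b = 1] fails, its opposite works. *)
Lemma hyperbolic_shift (F : fieldType) (w0 w1 w2 : F) : (2 : F) != 0 -> w2 != 0 ->
  exists a b, a ^+ 2 - b ^+ 2 = w0 ^+ 2 - w1 ^+ 2 - w2 ^+ 2 /\
    (w0 - a) ^+ 2 - (w1 - b) ^+ 2 - w2 ^+ 2 != 0.
Proof.
move=> two0 w20; set q := w0 ^+ 2 - w1 ^+ 2 - w2 ^+ 2.
(* Chosen so that [a + b = 1] and [a - b = q]. *)
pose a := (1 + q) / 2; pose b := (1 - q) / 2.
have ab : a ^+ 2 - b ^+ 2 = q by rewrite /a /b; field.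
have [e1|] := eqVneq ((w0 - a) ^+ 2 - (w1 - b) ^+ 2 - w2 ^+ 2) 0; last first.
  by exists a, b.
exists (- a), (- b); rewrite !sqrrN; split=> //; rewrite !opprK; apply/eqP => e2.
(* The two values add up to [4 * q]. With [q = 0] they differ by [2 * (w0 - w1)], and [w0 = w1]
   leaves [q = - w2 ^+ 2], which is nonzero. *)
have q0 : q = 0.
  apply: (mulfI two0); apply: (mulfI two0); rewrite !mulr0.
  transitivity (((w0 - a) ^+ 2 - (w1 - b) ^+ 2 - w2 ^+ 2) +
    ((w0 + a) ^+ 2 - (w1 + b) ^+ 2 - w2 ^+ 2)).
    transitivity (2 * q + 2 * (a ^+ 2 - b ^+ 2)); first by rewrite ab; ring.
    by rewrite /q; ring.
  by rewrite e1 e2 addr0.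
have w01 : w0 = w1.
  apply/eqP; rewrite -subr_eq0; apply/eqP; apply: (mulfI two0); rewrite mulr0.
  transitivity (((w0 + a) ^+ 2 - (w1 + b) ^+ 2 - w2 ^+ 2) -
    ((w0 - a) ^+ 2 - (w1 - b) ^+ 2 - w2 ^+ 2)); last by rewrite e1 e2 subrr.
  by rewrite /a /b q0; field.
move: q0; rewrite /q w01 subrr sub0r => /eqP.
by rewrite oppr_eq0 sqrf_eq0 (negPf w20).
Qed.

Section LorentzInvariance.
Variables (p : nat) (p_pr : prime p) (p_odd : p <> 2%N).
Local Notation Qp := (padic p_pr).
Local Notation sg := (lorentz_sign p_pr).
Local Notation form := (diag_form sg).
Variables (m : Qp) (m0 : m <> 0) (R : realType).
Variables (mu : {measure set (Qpn p_pr 3) -> \bar R}).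
Variable lam : {measure set (Qpn p_pr 4) -> \bar R}.
Hypotheses (hmu : normalized_haar mu) (hlam : gelfand_leray mu m lam).
Implicit Types (M N : 'M[Qp]_4) (v x y e : 'cV[Qp]_4).

Local Notation preserving M := (measure_preserving lam (mulQpn M)).

Definition form_isometry M : Prop :=
  forall x y, form (M *m x) (M *m y) = form x y.

(* Members of the group generated by reflections in vectors with a zero coordinate,
   seen through what they are used for. *)
Definition absorbable N : Prop :=
  form_isometry N /\ forall M, preserving (N *m M) -> preserving M.

Lemma mulQpnM M N : mulQpn (M *m N) = mulQpn M \o mulQpn N.
Proof. by apply/funext => x; rewrite /mulQpn /= mulmxA. Qed.

Lemma form_isometryM M N :
  form_isometry M -> form_isometry N -> form_isometry (M *m N).
Proof. by move=> Mi Ni x y; rewrite -!mulmxA Mi Ni. Qed.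

Lemma absorbableM M N : absorbable M -> absorbable N -> absorbable (M *m N).
Proof.
move=> [Mi Ma] [Ni Na]; split; first exact: form_isometryM.
by move=> K; rewrite -mulmxA => /Ma /Na.
Qed.

Lemma absorbable_refl (l : 'I_4) v : v l 0 = 0 -> form v v != 0 ->
  absorbable (diag_refl sg v).
Proof.
move=> vl v0; split; first by move=> x y; exact: diag_refl_form.
have rP : preserving (diag_refl sg v).
  have := col_insert_remove l v; rewrite vl; move: (col_remove l v) => r rv.
  rewrite -rv; apply: (refl_measure_preserving p_odd m0 hmu hlam).
  by rewrite -rv diag_form_insert !mulr0 add0r in v0.
move=> M /(measure_preserving_comp rP); rewrite -mulQpnM mulmxA.
by rewrite diag_refl_involutive // mul1mx.
Qed.

Lemma diag_refl_fix v x : form v x = 0 -> diag_refl sg v *m x = x.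
Proof. by move=> vx; rewrite diag_reflE vx mulr0 scale0r subr0. Qed.

(** If [y - e] is isotropic, a reflection in [y + e] takes [y] to [- e], and one in [e] restores the
    sign. The last clause keeps basis vectors already treated in place. *)
Lemma absorbable_exchange (l : 'I_4) y e : y l 0 = 0 -> e l 0 = 0 ->
  form y y = form e e -> form e e != 0 ->
  exists N, [/\ absorbable N, N *m y = e &
    forall x, form y x = 0 -> form e x = 0 -> N *m x = x].
Proof.
move=> yl el ye e0; have two0 : (2 : Qp) != 0 by exact: padic_natr_neq0.
have [d0|d0] := eqVneq (form (y - e) (y - e)) 0; last first.
  exists (diag_refl sg (y - e)); split.
  - by apply: (absorbable_refl (l := l)) => //; rewrite !mxE yl el subrr.
  - exact: diag_refl_swap.
  - by move=> x yx ex; rewrite diag_refl_fix // diag_formBl yx ex subrr.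
have Ne : form (- e) (- e) = form e e.
  by rewrite -scaleN1r diag_formZl diag_formC diag_formZl mulrA mulrNN !mul1r.
have s0 : form (y - - e) (y - - e) != 0.
  rewrite (diag_form_opposite ye d0); exact: mulf_neq0 (mulf_neq0 two0 two0) e0.
exists (diag_refl sg e *m diag_refl sg (y - - e)); split.
- apply: absorbableM; first exact: (absorbable_refl (l := l)).
  by apply: (absorbable_refl (l := l)) => //; rewrite !mxE yl el !oppr0 addr0.
- have ye' : form y y = form (- e) (- e) by rewrite Ne.
  rewrite -mulmxA [X in _ *m X](diag_refl_swap ye' s0) mulmxN.
  by rewrite [X in - X](diag_refl_self e0) opprK.
- move=> x yx ex; have sx : form (y - - e) x = 0.
    by rewrite diag_formBl yx -scaleN1r diag_formZl ex mulr0 subr0.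
  by rewrite -mulmxA [X in _ *m X](diag_refl_fix sx) (diag_refl_fix ex).
Qed.

Lemma form_delta (i : 'I_4) x : form (delta_mx i 0) x = sg i * x i 0.
Proof.
rewrite /diag_form (bigD1 i) //= big1 => [|j ji].
  by rewrite mxE !eqxx mul1r addr0.
by rewrite mxE (negPf ji) mul0r mulr0.
Qed.

(** [d] counts the basis vectors not yet known to be fixed. Each step returns the next one to its
    place by a map that fixes the earlier ones, since they are orthogonal to both vectors
    exchanged. *)
Lemma preserving_flag d M : (d <= 3)%N -> form_isometry M ->
  (forall i : 'I_4, (i + d < 4)%N -> M *m delta_mx i 0 = delta_mx i 0 :> 'cV_4) ->
  preserving M.
Proof.
elim: d M => [|d IHd] M d3 Mi Mfix.
  have -> : M = 1%:M.
    apply/matrixP => i j; have := Mfix j; rewrite addn0 => /(_ (ltn_ord j)).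
    move=> /matrixP/(_ i 0); rewrite -colE !mxE eqxx andbT => ->.
    by [].
  rewrite (_ : mulQpn 1%:M = id); last first.
    by apply/funext => x; exact: mul1mx.
  split; first exact: measurable_id.
  by move=> A _; rewrite preimage_id.
have kd : (3 - d < 4)%N by lia.
pose k : 'I_4 := Ordinal kd; pose e : 'cV[Qp]_4 := delta_mx k 0.
have orth (i : 'I_4) : (i + d.+1 < 4)%N -> form e (delta_mx i 0) = 0.
  move=> ik; rewrite form_delta mxE; case: eqP => [ki|_]; last by rewrite mulr0.
  by move: ik; rewrite -ki /=; lia.
have Morth (i : 'I_4) : (i + d.+1 < 4)%N -> form (M *m e) (delta_mx i 0) = 0.
  by move=> ik; rewrite -(Mfix i ik) Mi orth.
(* As [d.+1 <= 3], basis vector 0 is already fixed; [e] and [M *m e] are orthogonal to it, so their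
   coordinate 0 vanishes. *)
have [||||N [[Ni Na] Ny Nfix]] := @absorbable_exchange 0 (M *m e) e.
- have := Morth 0; rewrite diag_formC form_delta => /(_ _)/eqP.
  rewrite mulf_eq0 (negPf (lorentz_sign_neq0 _ _)) /= => h.
  by apply/eqP/h; rewrite add0n; lia.
- by rewrite mxE; case: eqP => // /(congr1 val) /=; lia.
- exact: Mi.
- rewrite form_delta mxE !eqxx mulr1; exact: lorentz_sign_neq0.
apply: Na; apply: IHd; first by lia.
  exact: form_isometryM.
move=> i id; rewrite -mulmxA; have [ik|ik] := ltnP (i + d.+1) 4.
  by rewrite Mfix // Nfix // ?Morth ?orth.
have -> : i = k by apply: val_inj => /=; lia.
exact: Ny.
Qed.

(* Makes [y - e] and [y + e], for [e] the first basis vector, eligible for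
   [absorbable_refl]. *)
Lemma absorbable_coord2 y : exists N, absorbable N /\ (N *m y) 2 0 = 0.
Proof.
have [y2|y2] := eqVneq (y 2 0) 0.
  exists 1%:M; rewrite mul1mx; split=> //.
  split; first by move=> u v; rewrite !mul1mx.
  by move=> M; rewrite mul1mx.
have two0 : (2 : Qp) != 0 by exact: padic_natr_neq0.
have [a [b [ab z0]]] := hyperbolic_shift (y 0 0) (y 1 0) two0 y2.
pose t : 'cV[Qp]_4 :=
  \col_i [eta fun=> y 3 0 with 0 |-> a, 1 |-> b, 2 |-> 0] i.
have yt : form y y = form t t.
  rewrite -!lorentz_formE /lorentz_form !mxE /= -!expr2 ab expr0n /=.
  by rewrite subr0.
have z0' : form (y - t) (y - t) != 0.
  by rewrite -lorentz_formE /lorentz_form !mxE /= subr0 subrr mulr0 subr0 -!expr2.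
exists (diag_refl sg (y - t)); split.
  apply: (absorbable_refl (l := 3)) z0'.
  by rewrite !mxE /= subrr.
by rewrite (diag_refl_swap yt z0') mxE.
Qed.

(** With no basis vector fixed yet, there is no common zero coordinate for the first exchange;
    coordinate 2, zero in [e], is first cleared in the image of [e]. *)
Lemma isometry_preserving M : form_isometry M -> preserving M.
Proof.
move=> Mi; pose e : 'cV[Qp]_4 := delta_mx 0 0.
have ee : form e e = 1 by rewrite form_delta mxE !eqxx mulr1.
have [N [[Ni Na] N2]] := absorbable_coord2 (M *m e).
have [||||K [[Ki Ka] Ke _]] := @absorbable_exchange 2 (N *m (M *m e)) e.
- exact: N2.
- by rewrite mxE.
- by rewrite Ni Mi.
- by rewrite ee oner_neq0.
apply: Na; apply: Ka; apply: (@preserving_flag 3) => //.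
  by apply: form_isometryM => //; exact: form_isometryM.
move=> i i0; have -> : i = 0 by apply: val_inj => /=; lia.
by rewrite -!mulmxA.
Qed.

End LorentzInvariance.

Theorem lemma4 (R : realType) (p : nat) (p_pr : prime p) (hp2 : p <> 2%N)
  (m : padic p_pr) (hm : m <> 0)
  (mu : {measure set (Qpn p_pr 3) -> \bar R}) (hmu : normalized_haar mu)
  (lam : {measure set (Qpn p_pr 4) -> \bar R}) (hlam : gelfand_leray mu m lam)
  (G : set 'M[padic p_pr]_4) (hG : restricted_lorentz m G) :
  invariant_distr G (delta lam m false) /\ invariant_distr G (delta lam m true).
Proof.
have [[_ GSO GV] _] := hG.
suff inv s : invariant_distr G (delta lam m s) by split.
move=> L GL phi _; have [Lu Lform _] := GSO _ GL.
have LP : measure_preserving lam (mulQpn L).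
  apply: (isometry_preserving hp2 hm hmu hlam) => x y.
  by rewrite -!lorentz_formE.
have LK : cancel (mulQpn L) (mulQpn (invmx L)).
  by move=> x; rewrite /mulQpn mulmxA mulVmx // mul1mx.
have KL : cancel (mulQpn (invmx L)) (mulQpn L).
  by move=> x; rewrite /mulQpn mulmxA mulmxV // mul1mx.
(* [GV] speaks of images, while the change of variables needs a preimage; injectivity of [L]
   converts one into the other. *)
have LV : mulQpn L @^-1` half_hyperboloid m s = half_hyperboloid m s.
  apply/seteqP; split=> x; rewrite /preimage /= -{1}(GV _ GL s).
    by move=> [y Vy /(can_inj LK) <-].
  by rewrite (GV _ GL s) => Vx; rewrite -(GV _ GL s); exists x.
have intE (f : Qpn p_pr 4 -> R) :
    (\int[lam]_(k in half_hyperboloid m s) f (mulQpn L k))%R =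
    (\int[lam]_(k in half_hyperboloid m s) f k)%R.
  rewrite /Rintegral -{1}LV; congr fine.
  exact: (integral_measure_preserving _ (EFin \o f) LK KL (measurable_mulQpn _) LP).
(* The two inversions, in the actions on distributions and on functions, cancel, and the integrand
   becomes [phi (L *m k)]. *)
rewrite /GL_act_distr /GL_act /delta; congr complex.Complex.
  by rewrite invmxK; exact: (intE (fun k => complex.Re (phi k))).
by rewrite invmxK; exact: (intE (fun k => complex.Im (phi k))).
Qed.
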